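(* Let $k$ be a field of characteristic $0$ and $W$ a finite-dimensional $k$-vector space. The derived variety of 1-periodic complexes $\mathrm{RPCom}(W)=\operatorname{Spec}C^\bullet(\widetilde A,k)$, where $A=\operatorname{End}(W)$ and $\widetilde A=tA[t]$, is a Poisson dg-manifold: $C^\bullet(\widetilde A,k)$, with the bracket determined by the $(-1)$-shifted Lie bialgebra structure on $\widetilde A$ described in the context, is a differential (non-shifted) Poisson algebra. Moreover, the restriction of this Poisson structure to $H^0(\widetilde A,k)$, the ring of functions on $\mathrm{PCom}(W)$, coincides with the standard Kirillov–Kostant Poisson structure on $\mathrm{PCom}(W)$.
   Context: Gradings are by $\mathbb Z$; $(U[m])^i=U^{i+m}$; $U^*$ is the graded dual. $\mathrm{PCom}(W)\subset\operatorname{End}(W)$ is the affine scheme of square-zero endomorphisms: with $e_{ij}$ the elementary-matrix basis of $\operatorname{End}(W)$ and $x_{ij}$ the dual basis of $\operatorname{End}(W)^*$, its ring of functions is $S^\bullet(\operatorname{End}(W)^* )/I$, where $I$ is generated by $\sum_k x_{ik}x_{kj}$ for all $i,j$. The Kirillov–Kostant bracket on $S^\bullet(\operatorname{End}(W)^* )$ is the Poisson bracket which on linear functions is the Lie bracket on $\operatorname{End}(W)^*$ obtained by identifying $\operatorname{End}(W)^*\cong\operatorname{End}(W)$ via the trace form $(a,b)_A=\operatorname{tr}(ab)$; it descends to a Poisson structure on $\mathrm{PCom}(W)$. Let $A=\operatorname{End}(W)$ in degree $0$ and $\deg t=1$. $\widetilde A=tA[t]$ is a graded Lie algebra with $[at^p,bt^q]=(ab-(-1)^{pq}ba)t^{p+q}$;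 the same formula is used on $A((t^{-1}))$ and on its subalgebra $A[[t^{-1}]]$. The form $(f,g)=$ the coefficient of $t^1$ in $(f,g)_A$ on $A((t^{-1}))$ is symmetric, invariant and non-degenerate, takes values in $k[-1]$, and $\widetilde A$ and $A[[t^{-1}]]$ are complementary isotropic subalgebras. All completions are understood in the graded sense (degree $-r$ part of $A[[t^{-1}]]$ is $At^{-r}$). The form identifies $A[[t^{-1}]]$ with $\widetilde A^*[-1]$ via $x\mapsto(x,-)$, and the Lie bracket on $\widetilde A^*[-1]$ so obtained is the dual $\phi^*$ of the cobracket of the $(-1)$-shifted Lie bialgebra structure on $\widetilde A$. $C^\bullet(\widetilde A,k)=S^\bullet(\widetilde A^*[-1])=S^\bullet(A[[t^{-1}]])$ is the Chevalley–Eilenberg cochain algebra, with differential of degree $+1$ dual to the bracket of $\widetilde A$; its Poisson bracket is the Lie bracket of $A[[t^{-1}]]$ on generators, extended by the derivation rule. $H^0(\widetilde A,k)$ is its degree $0$ cohomology. A differential Poisson algebra is a graded-commutative dg algebra $(B,d)$ with a degree $0$ graded Lie bracket such that $\langle x,yz\rangle=\langle x,y\rangle z+(-1)^{|x||y|}y\langle x,z\rangle$ and $d\langle x,y\rangle=\langle dx,y\rangle+(-1)^{|x|}\langle x,dy\rangle$. *)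

(* Defs.v *)
From HB Require Import structures.
From mathcomp Require Import all_boot all_algebra.
From mathcomp Require Import boolp.
From mathcomp.multinomials Require Import monalg.

Set Implicit Arguments.
Unset Strict Implicit.
Unset Printing Implicit Defensive.

Import GRing.Theory.
Local Open Scope ring_scope.

(* Quotient of an algebra by the two-sided ideal generated by a set of        *)
(* elements. It may be the zero ring, whereas lalgType and algType require    *)
(* 1 != 0: the quotient is therefore equipped with a pzRingType structure and *)
(* an lmodType structure.                                                     *)
Section AlgQuotient.
Variables (k : fieldType) (B : algType k) (S : B -> Prop).

Inductive ideal_gen : B -> Prop :=
| ideal_gen0 : ideal_gen 0
| ideal_genS a s b x : S s -> ideal_gen x -> ideal_gen (a * s * b + x).

Lemma ideal_genD x y : ideal_gen x -> ideal_gen y -> ideal_gen (x + y).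
Proof.
move=> Jx Jy; elim: Jx => [|a s b z Ss _ IH]; first by rewrite add0r.
by rewrite -addrA; apply: ideal_genS.
Qed.

Lemma ideal_genMl c x : ideal_gen x -> ideal_gen (c * x).
Proof.
elim=> [|a s b z Ss _ IH]; first by rewrite mulr0; apply: ideal_gen0.
by rewrite mulrDr !mulrA; apply: ideal_genS.
Qed.

Lemma ideal_genMr c x : ideal_gen x -> ideal_gen (x * c).
Proof.
elim=> [|a s b z Ss _ IH]; first by rewrite mul0r; apply: ideal_gen0.
by rewrite mulrDl -mulrA; apply: ideal_genS.
Qed.

Lemma ideal_genZ (c : k) x : ideal_gen x -> ideal_gen (c *: x).
Proof. by rewrite -mulr_algl; apply: ideal_genMl. Qed.

Lemma ideal_genN x : ideal_gen x -> ideal_gen (- x).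
Proof. by rewrite -scaleN1r; apply: ideal_genZ. Qed.

Lemma ideal_gen_sub s : S s -> ideal_gen s.
Proof.
by move=> Ss; rewrite -[s]addr0 -[s]mulr1 -[s]mul1r;
  apply: ideal_genS Ss ideal_gen0.
Qed.

Definition ideal_equiv : rel B := fun x y => `[< ideal_gen (x - y) >].

Lemma ideal_equiv_is_equiv : equiv_class_of ideal_equiv.
Proof.
split=> [x|x y|y x z].
- by apply/asboolP; rewrite subrr; apply: ideal_gen0.
- by apply/asboolP/asboolP => /ideal_genN; rewrite opprB.
- move=> /asboolP Jxy /asboolP Jyz; apply/asboolP.
  by rewrite -(subrK y x) -addrA; apply: ideal_genD.
Qed.

Canonical ideal_equiv_equiv := EquivRelPack ideal_equiv_is_equiv.

Local Open Scope quotient_scope.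

Definition alg_quot := {eq_quot ideal_equiv}.
HB.instance Definition _ := Choice.on alg_quot.
HB.instance Definition _ := EqQuotient.on alg_quot.

Definition alg_pi (x : B) : alg_quot := \pi_alg_quot x.

Lemma alg_piP x y : alg_pi x = alg_pi y <-> ideal_gen (x - y).
Proof.
split=> [/eqP|Jxy]; first by rewrite /alg_pi eqmodE => /asboolP.
by apply/eqP; rewrite /alg_pi eqmodE; apply/asboolP.
Qed.

Lemma alg_pi_surj q : exists x, q = alg_pi x.
Proof. by exists (repr q); rewrite /alg_pi reprK. Qed.

Lemma alg_repr x : ideal_gen (repr (alg_pi x) - x).
Proof. by apply/alg_piP; rewrite /alg_pi reprK. Qed.

Definition alg_quot_add (p q : alg_quot) := alg_pi (repr p + repr q).
Definition alg_quot_opp (p : alg_quot) := alg_pi (- repr p).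
Definition alg_quot_mul (p q : alg_quot) := alg_pi (repr p * repr q).
Definition alg_quot_scale (c : k) (p : alg_quot) := alg_pi (c *: repr p).

Lemma alg_quot_addE x y :
  alg_quot_add (alg_pi x) (alg_pi y) = alg_pi (x + y).
Proof.
by apply/alg_piP; rewrite opprD addrACA; apply: ideal_genD; apply: alg_repr.
Qed.

Lemma alg_quot_oppE x : alg_quot_opp (alg_pi x) = alg_pi (- x).
Proof. by apply/alg_piP; rewrite -opprD; apply/ideal_genN/alg_repr. Qed.

Lemma alg_quot_mulE x y :
  alg_quot_mul (alg_pi x) (alg_pi y) = alg_pi (x * y).
Proof.
apply/alg_piP; set u := repr _; set v := repr _.
rewrite -[u * v](subrK (x * v)) -addrA -mulrBl -mulrBr.
by apply: ideal_genD; [apply: ideal_genMr | apply: ideal_genMl];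
  apply: alg_repr.
Qed.

Lemma alg_quot_scaleE c x : alg_quot_scale c (alg_pi x) = alg_pi (c *: x).
Proof. by apply/alg_piP; rewrite -scalerBr; apply/ideal_genZ/alg_repr. Qed.

Let quotE :=
  (alg_quot_addE, alg_quot_oppE, alg_quot_mulE, alg_quot_scaleE).

Fact alg_quot_addA : associative alg_quot_add.
Proof.
move=> p q r; have [x ->] := alg_pi_surj p; have [y ->] := alg_pi_surj q.
by have [z ->] := alg_pi_surj r; rewrite !quotE addrA.
Qed.

Fact alg_quot_addC : commutative alg_quot_add.
Proof.
move=> p q; have [x ->] := alg_pi_surj p; have [y ->] := alg_pi_surj q.
by rewrite !quotE addrC.
Qed.

Fact alg_quot_add0 : left_id (alg_pi 0) alg_quot_add.
Proof. by move=> p; have [x ->] := alg_pi_surj p; rewrite !quotE add0r. Qed.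

Fact alg_quot_addN : left_inverse (alg_pi 0) alg_quot_opp alg_quot_add.
Proof. by move=> p; have [x ->] := alg_pi_surj p; rewrite !quotE addNr. Qed.

HB.instance Definition _ := GRing.isZmodule.Build alg_quot
  alg_quot_addA alg_quot_addC alg_quot_add0 alg_quot_addN.

Fact alg_quot_mulA : associative alg_quot_mul.
Proof.
move=> p q r; have [x ->] := alg_pi_surj p; have [y ->] := alg_pi_surj q.
by have [z ->] := alg_pi_surj r; rewrite !quotE mulrA.
Qed.

Fact alg_quot_mul1 : left_id (alg_pi 1) alg_quot_mul.
Proof. by move=> p; have [x ->] := alg_pi_surj p; rewrite !quotE mul1r. Qed.

Fact alg_quot_mulr1 : right_id (alg_pi 1) alg_quot_mul.
Proof. by move=> p; have [x ->] := alg_pi_surj p; rewrite !quotE mulr1. Qed.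

Fact alg_quot_mulDl : left_distributive alg_quot_mul +%R.
Proof.
move=> p q r; have [x ->] := alg_pi_surj p; have [y ->] := alg_pi_surj q.
have [z ->] := alg_pi_surj r.
by rewrite -[_ + _]/(alg_quot_add _ _) -[RHS]/(alg_quot_add _ _) !quotE mulrDl.
Qed.

Fact alg_quot_mulDr : right_distributive alg_quot_mul +%R.
Proof.
move=> p q r; have [x ->] := alg_pi_surj p; have [y ->] := alg_pi_surj q.
have [z ->] := alg_pi_surj r.
rewrite -[alg_pi y + _]/(alg_quot_add _ _) -[RHS]/(alg_quot_add _ _).
by rewrite !quotE mulrDr.
Qed.

HB.instance Definition _ := GRing.Zmodule_isPzRing.Build alg_quot
  alg_quot_mulA alg_quot_mul1 alg_quot_mulr1 alg_quot_mulDl alg_quot_mulDr.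

Fact alg_quot_scaleA a b p :
  alg_quot_scale a (alg_quot_scale b p) = alg_quot_scale (a * b) p.
Proof. by have [x ->] := alg_pi_surj p; rewrite !quotE scalerA. Qed.

Fact alg_quot_scale1 : left_id 1 alg_quot_scale.
Proof. by move=> p; have [x ->] := alg_pi_surj p; rewrite !quotE scale1r. Qed.

Fact alg_quot_scaleDr : right_distributive alg_quot_scale +%R.
Proof.
move=> a p q; have [x ->] := alg_pi_surj p; have [y ->] := alg_pi_surj q.
rewrite -[alg_pi x + _]/(alg_quot_add _ _) -[RHS]/(alg_quot_add _ _).
by rewrite !quotE scalerDr.
Qed.

Fact alg_quot_scaleDl p : {morph alg_quot_scale^~ p : a b / a + b}.
Proof.
move=> a b; have [x ->] := alg_pi_surj p.
by rewrite -[RHS]/(alg_quot_add _ _) !quotE scalerDl.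
Qed.

HB.instance Definition _ := GRing.Zmodule_isLmodule.Build k alg_quot
  alg_quot_scaleA alg_quot_scale1 alg_quot_scaleDr alg_quot_scaleDl.

Fact alg_pi_linear : linear alg_pi.
Proof.
move=> a x y; rewrite -alg_quot_addE -alg_quot_scaleE.
by [].
Qed.

Fact alg_pi_monoid_morphism : monoid_morphism alg_pi.
Proof. by split=> // x y; rewrite -alg_quot_mulE. Qed.

HB.instance Definition _ :=
  GRing.isLinear.Build k B alg_quot *:%R alg_pi alg_pi_linear.
HB.instance Definition _ :=
  GRing.isMonoidMorphism.Build B alg_quot alg_pi alg_pi_monoid_morphism.

Lemma alg_quot_scalerAl (c : k) (p q : alg_quot) :
  c *: (p * q) = (c *: p) * q.
Proof.
have [x ->] := alg_pi_surj p; have [y ->] := alg_pi_surj q.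
by rewrite -rmorphM -!linearZ -rmorphM /= scalerAl.
Qed.

Lemma alg_quot_scalerAr (c : k) (p q : alg_quot) :
  c *: (p * q) = p * (c *: q).
Proof.
have [x ->] := alg_pi_surj p; have [y ->] := alg_pi_surj q.
by rewrite -rmorphM -!linearZ -rmorphM /= scalerAr.
Qed.

End AlgQuotient.

Arguments alg_pi {k B S} x.

(* The free associative algebra on a set of letters. A synonym is needed      *)
(* because an algType instance on {malg _[_]} is already declared for         *)
(* commutative monoids.                                                       *)
Section FreeAlgebra.
Variables (k : fieldType) (X : choiceType).

Definition free_alg := {malg k[{fmonom X}]}.

Fact free_alg_scalerAr (c : k) (x y : {malg k[{fmonom X}]}) :
  c *: (x * y) = x * (c *: y).
Proof.
have malgCC : x * c%:MP = c%:MP * x.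
  rewrite !malgM_def fgmulgU fgmulUg; apply: eq_bigr => m _.
  by rewrite mul1m mulm1 mulrC.
by rewrite -!mul_malgC [RHS]mulrA malgCC mulrA.
Qed.

HB.instance Definition _ := GRing.Lalgebra.on free_alg.
HB.instance Definition _ :=
  GRing.Lalgebra_isAlgebra.Build k free_alg free_alg_scalerAr.

Definition letter (x : X) : free_alg := << fmu x >>.

Definition free_alg_aug (x : free_alg) : k :=
  mcoeff (mone : {fmonom X}) (x : {malg k[{fmonom X}]}).

Fact free_alg_aug_linear : scalar free_alg_aug.
Proof. by move=> a x y; rewrite /free_alg_aug mcoeffD mcoeffZ. Qed.

HB.instance Definition _ :=
  GRing.isLinear.Build k free_alg k *%R free_alg_aug free_alg_aug_linear.

Fact free_alg_aug_monoid_morphism : monoid_morphism free_alg_aug.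
Proof.
by split=> [|x y]; [exact: (rmorph1 (mcoeff (mone : {fmonom X}))) | exact: (rmorphM (mcoeff (mone : {fmonom X})))].
Qed.

HB.instance Definition _ := GRing.isMonoidMorphism.Build free_alg k
  free_alg_aug free_alg_aug_monoid_morphism.

Lemma free_alg_aug_letter x : free_alg_aug (letter x) = 0.
Proof.
rewrite /free_alg_aug mcoeffU; case: eqP => // /(congr1 (@fdeg X)).
by rewrite fdegU fdeg1.
Qed.

End FreeAlgebra.

(* The Koszul sign (-1)^n. *)
Definition ksign (k : fieldType) (n : int) : k := (-1) ^+ `|n|%N.
Arguments ksign {k} n.

(* The free graded-commutative algebra S^.(U) on the graded vector space U    *)
(* which is the direct sum over i : I of a copy of V placed in degree deg i:  *)
(* the quotient of the free associative algebra on the symbols (i, v) by the  *)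
(* linearity relations (giving the tensor algebra of U) and the graded        *)
(* commutativity relations.                                                   *)
Section GradedSymmetricAlgebra.
Variables (k : fieldType) (I : choiceType) (deg : I -> int) (V : lmodType k).

Local Notation T := (free_alg k (I * V)%type).
Local Notation "[ i , v ]" := (letter k (i, v)) (format "[ i ,  v ]").

Inductive gsym_rel : T -> Prop :=
| gsym_rel_lin i a (v w : V) :
    gsym_rel ([i, a *: v + w] - (a *: [i, v] + [i, w]))
| gsym_rel_comm i j (v w : V) :
    gsym_rel ([i, v] * [j, w] - ksign (deg i * deg j) *: ([j, w] * [i, v])).

Definition gsym := alg_quot gsym_rel.

HB.instance Definition _ := GRing.PzRing.on gsym.
HB.instance Definition _ := GRing.Lmodule.on gsym.

Fact gsym_oner_neq0 : 1 != 0 :> gsym.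
Proof.
apply/eqP => /(alg_piP gsym_rel 1 0); rewrite subr0 => J1.
suff J_aug x : ideal_gen gsym_rel x -> free_alg_aug x = 0.
  by have /eqP := J_aug _ J1; rewrite rmorph1 oner_eq0.
elim=> [|a s b y Rs _ IH]; first exact: raddf0.
rewrite rmorphD !rmorphM /= IH addr0; suff -> : free_alg_aug s = 0.
  by rewrite mulr0 mul0r.
case: s / Rs => [i c v w|i j v w].
  by rewrite raddfB /= linearP /= !free_alg_aug_letter mulr0 addr0 subr0.
rewrite raddfB /= linearZ /= !rmorphM /= !free_alg_aug_letter.
by rewrite !mulr0 subr0.
Qed.

HB.instance Definition _ :=
  GRing.PzSemiRing_isNonZero.Build gsym gsym_oner_neq0.
HB.instance Definition _ := GRing.LSemiModule_isLSemiAlgebra.Build k gsym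
  (@alg_quot_scalerAl k T gsym_rel).
HB.instance Definition _ := GRing.LSemiAlgebra_isSemiAlgebra.Build k gsym
  (@alg_quot_scalerAr k T gsym_rel).

Definition gsym_pi (x : T) : gsym := alg_pi x.

Definition gen (i : I) (v : V) : gsym := gsym_pi [i, v].

Definition word_deg (w : {fmonom (I * V)%type}) : int :=
  \sum_(l <- (w : seq _)) deg l.1.

Definition gsym_deg (n : int) (x : gsym) : Prop :=
  exists2 t : T, x = gsym_pi t
    & forall w, mcoeff w (t : {malg k[_]}) != 0 -> word_deg w = n.

End GradedSymmetricAlgebra.

Arguments gen {k I} deg {V} i v.

(* B n x means that x is homogeneous of degree n.                             *)
Section DifferentialPoisson.
Variables (k : fieldType) (A : algType k) (B : int -> A -> Prop).

Record is_graded_algebra : Prop := IsGradedAlgebra {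
  graded0 : forall n, B n 0;
  gradedP : forall n a x y, B n x -> B n y -> B n (a *: x + y);
  graded1 : B 0 1;
  gradedM : forall m n x y, B m x -> B n y -> B (m + n) (x * y);
  graded_span : forall x, exists (s : seq int) (f : int -> A),
    (forall n, B n (f n)) /\ x = \sum_(n <- s) f n;
  graded_free : forall (s : seq int) (f : int -> A), uniq s ->
    (forall n, B n (f n)) -> \sum_(n <- s) f n = 0 ->
    forall n, n \in s -> f n = 0 }.

Definition is_graded_commutative : Prop :=
  forall m n x y, B m x -> B n y -> x * y = ksign (m * n) *: (y * x).

Record is_differential (d : A -> A) : Prop := IsDifferential {
  diff_linear : linear d;
  diff_deg : forall n x, B n x -> B (n + 1) (d x);
  diff_square : forall x, d (d x) = 0;
  diffM : forall n x y, B n x -> d (x * y) = d x * y + ksign n *: (x * d y) }.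

Record is_graded_lie (br : A -> A -> A) : Prop := IsGradedLie {
  lie_linear : forall x, linear (br x);
  lie_linearl : forall y, linear (br^~ y);
  lie_deg : forall m n x y, B m x -> B n y -> B (m + n) (br x y);
  lie_anti : forall m n x y, B m x -> B n y ->
    br x y = - ksign (m * n) *: br y x;
  lie_jacobi : forall m n x y z, B m x -> B n y ->
    br x (br y z) = br (br x y) z + ksign (m * n) *: br y (br x z) }.

Record is_differential_poisson (d : A -> A) (br : A -> A -> A) : Prop :=
  IsDifferentialPoisson {
  dp_graded : is_graded_algebra;
  dp_comm : is_graded_commutative;
  dp_diff : is_differential d;
  dp_lie : is_graded_lie br;
  dp_leibniz : forall m n x y z, B m x -> B n y ->
    br x (y * z) = br x y * z + ksign (m * n) *: (y * br x z);
  dp_compat : forall m x y, B m x ->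
    d (br x y) = br (d x) y + ksign m *: br x (d y) }.

Record diff_poisson := DiffPoisson {
  dp_d : A -> A;
  dp_br : A -> A -> A;
  dp_axioms : is_differential_poisson dp_d dp_br }.

End DifferentialPoisson.

Section H0.
Variables (k : fieldType) (A : algType k) (B : int -> A -> Prop).
Variable P : diff_poisson B.

Local Notation d := (dp_d P).
Local Notation br := (dp_br P).

Definition Z0_pred : {pred A} := fun x => `[< B 0 x /\ d x = 0 >].

Record Z0 := CocycleZ0 { Z0_val : A; _ : Z0_val \in Z0_pred }.

HB.instance Definition _ := [isSub for Z0_val].
HB.instance Definition _ := [Choice of Z0 by <:].

Let Pdp := dp_axioms P.

Lemma Z0_predP x : reflect (B 0 x /\ d x = 0) (x \in Z0_pred).
Proof. exact: asboolP. Qed.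

Lemma Z0_deg (z : Z0) : B 0 (val z).
Proof. by have /Z0_predP[] := valP z. Qed.

Lemma Z0_closed (z : Z0) : d (val z) = 0.
Proof. by have /Z0_predP[] := valP z. Qed.

Fact Z0_subalg : GRing.subsemialg_closed Z0_pred.
Proof.
have gA := dp_graded Pdp; have dA := dp_diff Pdp.
pose dL := GRing.isLinear.Build k A A *:%R d (diff_linear dA).
pose D : {linear A -> A} := HB.pack d dL.
have d0 : d 0 = 0 := raddf0 D.
have dM x y : B 0 x -> d (x * y) = d x * y + x * d y.
  by move=> x0; rewrite (diffM dA y x0) /ksign expr0 scale1r.
split.
- apply/Z0_predP; split; first exact: graded1 gA.
  have := dM 1 1 (graded1 gA); rewrite !mul1r mulr1 => /eqP.
  by rewrite -subr_eq subrr eq_sym => /eqP.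
- split=> [|x y /Z0_predP[x0 dx] /Z0_predP[y0 dy]].
    by apply/Z0_predP; split; [exact: graded0 gA 0 | exact: d0].
  apply/Z0_predP; rewrite -[x]scale1r; split; first exact: gradedP.
  by rewrite (diff_linear dA) dx dy scaler0 addr0.
- move=> a x /Z0_predP[x0 dx]; apply/Z0_predP; rewrite -[_ *: _]addr0; split.
    exact: gradedP gA _ _ _ _ x0 (graded0 gA 0).
  by rewrite (diff_linear dA) dx d0 scaler0 addr0.
- move=> x y /Z0_predP[x0 dx] /Z0_predP[y0 dy]; apply/Z0_predP; split.
    by rewrite -[0]addr0; apply: gradedM.
  by rewrite dM // dx dy mul0r mulr0 addr0.
Qed.

HB.instance Definition _ :=
  GRing.SubChoice_isSubAlgebra.Build k A Z0_pred Z0 Z0_subalg.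

Definition B0 (z : Z0) : Prop := exists2 b, B (- 1) b & val z = d b.

Definition H0 := alg_quot B0.

HB.instance Definition _ := GRing.PzRing.on H0.
HB.instance Definition _ := GRing.Lmodule.on H0.

Definition H0_class (z : Z0) : H0 := alg_pi z.

Fact Z0_br_subproof (x y : Z0) : br (val x) (val y) \in Z0_pred.
Proof.
have dA := dp_diff Pdp; have lA := dp_lie Pdp.
have br0 u v : B 0 u -> v = 0 -> br u v = 0.
  move=> _ ->; have := lie_linear lA u 1 0 0.
  by rewrite scaler0 addr0 scale1r => /eqP; rewrite -subr_eq subrr => /eqP.
apply/Z0_predP; split.
  by rewrite -[0]addr0; apply: (lie_deg lA); apply: Z0_deg.
rewrite (dp_compat Pdp _ (Z0_deg x)) !Z0_closed.
have B10 : B 1 0 by apply: graded0 (dp_graded Pdp) _.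
rewrite (lie_anti lA B10 (Z0_deg y)) !br0 ?scaler0 ?addr0 //; exact: Z0_deg.
Qed.

Definition Z0_br (x y : Z0) : Z0 := CocycleZ0 (Z0_br_subproof x y).

Definition H0_br (p q : H0) : H0 :=
  H0_class (Z0_br (repr p) (repr q)).

Let d_linear := diff_linear (dp_diff Pdp).
Let d_pack := GRing.isLinear.Build k A A *:%R d d_linear.
Let D : {linear A -> A} := HB.pack d d_pack.
Let d0 : d 0 = 0 := raddf0 D.
Let dD x y : d (x + y) = d x + d y := raddfD D x y.

Lemma ideal_gen_B0 z : ideal_gen B0 z -> B0 z.
Proof.
have gA := dp_graded Pdp; have dA := dp_diff Pdp.
elim=> [|a s b x [c cB sE] _ [e eB xE]].
  by exists 0; [exact: graded0 gA _ | rewrite rmorph0 d0].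
exists (val a * c * val b + e).
  rewrite -[_ * _ * _]scale1r; apply: (gradedP gA) => //.
  rewrite -[- 1](addr0 (- 1)); apply: (gradedM gA); last exact: Z0_deg.
  by rewrite -[- 1](add0r (- 1)); apply: (gradedM gA) => //; apply: Z0_deg.
rewrite rmorphD !rmorphM /= sE xE dD -mulrA -[in RHS]mulrA.
rewrite (diffM dA _ (Z0_deg a)) (diffM dA _ cB) !Z0_closed.
by rewrite mul0r add0r mulr0 scaler0 addr0 /ksign expr0 scale1r.
Qed.

Lemma H0_classP x y : H0_class x = H0_class y <-> B0 (x - y).
Proof.
split=> [/alg_piP /ideal_gen_B0 // | xy].
by apply/alg_piP; apply: ideal_gen_sub.
Qed.

Lemma B0_Z0_br x y : B0 y -> B0 (Z0_br x y).
Proof.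
case=> b bB yE; exists (br (val x) b).
  by rewrite -[- 1](add0r (- 1)); apply: (lie_deg (dp_lie Pdp)) => //; apply: Z0_deg.
rewrite (dp_compat Pdp _ (Z0_deg x)) Z0_closed /= yE /ksign expr0 scale1r.
have B10 : B 1 0 by apply: graded0 (dp_graded Pdp) _.
have bB' : B (- 1) b by [].
rewrite (lie_anti (dp_lie Pdp) B10 bB').
suff -> : br b 0 = 0 by rewrite scaler0 add0r.
have := lie_linear (dp_lie Pdp) b 1 0 0.
by rewrite scaler0 addr0 scale1r => /eqP; rewrite -subr_eq subrr => /eqP.
Qed.

Lemma Z0_br_anti x y : Z0_br x y = - Z0_br y x.
Proof.
apply: val_inj; rewrite rmorphN /= (lie_anti (dp_lie Pdp) (Z0_deg x) (Z0_deg y)).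
by rewrite /ksign expr0 scaleN1r.
Qed.

Lemma Z0_brBr x y z : Z0_br x (y - z) = Z0_br x y - Z0_br x z.
Proof.
have vB u v : Z0_val (u - v) = Z0_val u - Z0_val v by exact: (rmorphB val).
apply: val_inj; rewrite [RHS](rmorphB val).
rewrite -[LHS]/(br (Z0_val x) (Z0_val (y - z))) vB -scaleN1r addrC.
by rewrite (lie_linear (dp_lie Pdp)) scaleN1r addrC.
Qed.

Lemma H0_brE x y : H0_br (H0_class x) (H0_class y) = H0_class (Z0_br x y).
Proof.
set x' := repr (H0_class x); set y' := repr (H0_class y).
have x'E : H0_class x' = H0_class x by rewrite /H0_class /alg_pi reprK.
have y'E : H0_class y' = H0_class y by rewrite /H0_class /alg_pi reprK.
rewrite /H0_br -/x' -/y'.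
transitivity (H0_class (Z0_br x' y)).
  by apply/H0_classP; rewrite -Z0_brBr; apply/B0_Z0_br/H0_classP.
apply/H0_classP; rewrite Z0_br_anti [Z0_br x y]Z0_br_anti -opprD opprB.
by rewrite -Z0_brBr; apply/B0_Z0_br/H0_classP.
Qed.

End H0.

(* Poisson bracket on an algebra placed in degree 0. *)
Record is_poisson (k : fieldType) (A : algType k) (br : A -> A -> A) : Prop :=
  IsPoisson {
  poisson_linear : forall x, linear (br x);
  poisson_anti : forall x y, br x y = - br y x;
  poisson_jacobi : forall x y z, br x (br y z) = br (br x y) z + br y (br x z);
  poisson_leibniz : forall x y z, br x (y * z) = br x y * z + y * br x z }.

Section PeriodicComplexes.
Variables (k : fieldType) (W : vectType k).

Local Notation End_W := 'End(W).
Local Notation End_dual := 'Hom(End_W, k^o).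
Local Notation w := (vbasis {:W}).
Local Notation n := (\dim {:W}).

(* x_ j l is the dual basis of the elementary matrices in the basis w of W:   *)
(* f (w_l) = \sum_j x_ j l f *: w_j.                                          *)
Definition x_ (j l : 'I_n) : End_dual :=
  linfun (fun f : End_W => coord w j (f w`_l) : k^o).

Definition tr_end (f : End_W) : k := \sum_(j < n) x_ j j f.

(* the linear form (a, -)_A *)
Definition tr_form (a : End_W) : End_dual :=
  linfun (fun b : End_W => tr_end (a \o b)%VF : k^o).

Definition S_End_dual := gsym (fun _ : unit => 0) End_dual.
HB.instance Definition _ := GRing.Algebra.on S_End_dual.

Definition lin_fun (xi : End_dual) : S_End_dual :=
  gen (fun _ : unit => 0) tt xi.

Definition PCom_eq (f : S_End_dual) : Prop :=
  exists i j : 'I_n, f = \sum_(l < n) lin_fun (x_ i l) * lin_fun (x_ l j).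

Definition O_PCom := alg_quot PCom_eq.
HB.instance Definition _ := GRing.PzRing.on O_PCom.
HB.instance Definition _ := GRing.Lmodule.on O_PCom.

Definition is_KK_End (br : S_End_dual -> S_End_dual -> S_End_dual) : Prop :=
  is_poisson br /\ forall a b : End_W,
    br (lin_fun (tr_form a)) (lin_fun (tr_form b))
    = lin_fun (tr_form ((a \o b)%VF - (b \o a)%VF)).

Definition is_KK_PCom (br : O_PCom -> O_PCom -> O_PCom) : Prop :=
  exists2 brS, is_KK_End brS &
    forall f g : S_End_dual, br (alg_pi f) (alg_pi g) = alg_pi (brS f g).

(* The graded vector space A((t^-1)), for A = End(W), has A t^p in each       *)
(* degree p : int; the bracket and the form are given on homogeneous          *)
(* components, a t^p being represented by a.                                  *)

Definition loop_br (p q : int) (a b : End_W) : End_W :=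
  (a \o b)%VF - ksign (p * q) *: (b \o a)%VF.

Definition loop_form (p q : int) (a b : End_W) : k :=
  if p + q == 1 then tr_end (a \o b)%VF else 0.

(* C^.(tA[t], k) = S^.((tA[t])^*[-1]). The degree -r part of (tA[t])^*[-1] is *)
(* the dual of A t^(r+1) for r >= 0, and its other components are zero.       *)

Definition CE_gen_deg (r : nat) : int := - r%:Z.

Definition CE := gsym CE_gen_deg End_dual.
HB.instance Definition _ := GRing.Algebra.on CE.

Definition CE_deg : int -> CE -> Prop := @gsym_deg k nat CE_gen_deg End_dual.

Definition CE_gen (r : nat) (xi : End_dual) : CE := gen CE_gen_deg r xi.

(* the functional (a t^-r, -) on tA[t] *)
Definition loop_dual (r : nat) (a : End_W) : End_dual :=
  linfun (fun b : End_W => loop_form (- r%:Z) r.+1%:Z a b : k^o).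

(* The Chevalley-Eilenberg differential on generators. Let (x_I) be a         *)
(* homogeneous basis of tA[t] and (x^I) the dual generators, of degrees       *)
(* 1 - |x_I|. For the universal element omega = \sum_I x^I x_I, of degree 1,  *)
(* the differential dual to the bracket is d omega = -1/2 [omega, omega], or  *)
(*  d xi = -1/2 \sum_(I, J) (-1)^(|x_I| (1 - |x_J|)) xi([x_I, x_J]) x^I x^J,  *)
(* the sign coming from the exchange of x_I and x^J.                          *)
Definition CE_d_gen (r : nat) (xi : End_dual) : CE :=
  let e := vbasis {:End_W} in
  let e_dual u : End_dual := linfun (fun b : End_W => coord e u b : k^o) in
  - (2%:R)^-1 *: \sum_(p < r) \sum_(q < r | (p.+1 + q.+1 == r.+1)%N)
      \sum_(u < \dim {:End_W}) \sum_(v < \dim {:End_W})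
        (ksign (p.+1%:Z * (1 - q.+1%:Z))
           * xi (loop_br p.+1%:Z q.+1%:Z e`_u e`_v))
        *: (CE_gen p (e_dual u) * CE_gen q (e_dual v)).

(* The differential Poisson structure on C^.(tA[t], k): the values on         *)
(* generators determine d and the bracket, both being derivations. The        *)
(* bracket on generators is the one of A[[t^-1]], transported by              *)
(* x |-> (x, -).                                                              *)
Definition is_CE_poisson (P : diff_poisson CE_deg) : Prop :=
  (forall r xi, dp_d P (CE_gen r xi) = CE_d_gen r xi) /\
  (forall r s a b,
     dp_br P (CE_gen r (loop_dual r a)) (CE_gen s (loop_dual s b))
     = CE_gen (r + s) (loop_dual (r + s) (loop_br (- r%:Z) (- s%:Z) a b))).

End PeriodicComplexes.

(* Main.v *)
(* A derivation or a biderivation of a free graded-commutative algebra is     *)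
(* determined by its values on generators, arbitrary up to linearity, degree, *)
(* antisymmetry. Hence d and the bracket exist, and d^2 = 0, the Jacobi       *)
(* identity and the compatibility of d with the bracket need only be checked  *)
(* on generators. With X_r the matrix of the coordinates x_ij in degree -r,   *)
(*   d X_r = - \sum_(p + q + 1 = r) (-1)^((p + 1) q) X_p X_q,                 *)
(*   {x_ij^r, x_kl^s} = delta_il x_kj^(r+s) - (-1)^(rs) delta_jk x_il^(r+s),  *)
(* so d^2 = 0 and the compatibility become identities between sums of         *)
(* products of two or three matrices.                                         *)
(* All degrees are <= 0, so every element of degree 0 is a cocycle, and       *)
(* cocycles of degree 0 are the polynomials in the entries of X_0. As         *)
(* d X_1 = - X_0^2, the projection of the Chevalley-Eilenberg algebra onto    *)
(* O(PCom(W)) killing all X_r with r > 0 vanishes on coboundaries; it induces *)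
(* the inverse of the map O(PCom(W)) -> H^0. Both Poisson brackets on         *)
(* polynomials in X_0 are biderivations with the same values on generators.   *)
Require Import Defs.
From HB Require Import structures.
From mathcomp Require Import all_boot all_algebra ring zify.
From mathcomp Require Import boolp finmap.
From mathcomp.multinomials Require Import monalg.

Set Implicit Arguments.
Unset Strict Implicit.
Unset Printing Implicit Defensive.

Import GRing.Theory.
Local Open Scope ring_scope.

(** * Maps out of the free graded-commutative algebra *)

(** The proof separates the free algebra from the loop algebra. [gsym_free] shows that [gsym]
    satisfies [is_free_gcomm], and almost everything later is proved for an abstract algebra with
    that property. There [free_diff] and [free_bracket] extend values on generators.
    [differential_poisson_from_gen] reduces the axioms to generators, because the defect of each
    identity is again a derivation in each argument.

    Three identities remain on generators. [loop_jacobi] is the Jacobi identity of the graded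
    commutator of $A[[t^{-1}]]$, carried over by the trace form. [loop_ddX] is associativity of the
    matrix product: the two bracketings of $X_aX_bX_c$ occur with opposite signs. [loop_compatX]
    compares $d\{X_r,X_s\}$ with brackets of quadratic terms. The terms carrying a Kronecker delta
    match one by one, and the other products cancel only in the total sum. Together these give
    [CE_poisson].

    For $H^0$, let [iota] include the polynomials in $X_0$ and let [rho] kill all $X_r$ with $r>0$.
    Since generators have degree at most 0, [iota] is onto the degree 0 part ([rhoK]) and consists
    of cocycles ([d_iota]). It sends the equations of $\mathrm{PCom}(W)$ to coboundaries
    ([square_exact]), while [rho] sends every coboundary into their ideal ([rho_d]). Hence [to_H0]
    and [of_H0] are inverse to each other. The brackets correspond by [iota_br], as biderivations
    with the same values on linear functions. The Kirillov-Kostant bracket on $\mathrm{PCom}(W)$ is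
    itself obtained from $H^0$ ([KK_PCom_of_H0]). *)

Section FreeAlgebraLift.
Variables (k : fieldType) (X : choiceType).

Local Notation T := (free_alg k X).

Definition word (s : seq X) : T := << FMonom s >>.

Lemma word_nil : word [::] = 1.
Proof. by rewrite /word -fmoneE. Qed.

Lemma letterE x : letter k x = word [:: x].
Proof. by rewrite /letter /word fmuE. Qed.

Lemma word_cat s t : word (s ++ t) = word s * word t.
Proof.
rewrite /word [RHS]malgM_def fgmulUU mulr1.
by congr (<< _ *g _ >>); rewrite /mmul /= fmmulE.
Qed.

Lemma word_cat3 u s w : word u * word s * word w = word (u ++ s ++ w).
Proof. by rewrite catA !word_cat. Qed.

Lemma free_algE (t : T) :
  t = \sum_(m <- msupp (t : {malg k[{fmonom X}]})) mcoeff m t *: word m.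
Proof.
rewrite [LHS](monalgE (t : {malg k[{fmonom X}]})); apply: eq_bigr => m _.
apply/malgP => m'.
by rewrite [RHS]mcoeffZ !mcoeffU /= fmK mulr_natr.
Qed.

Lemma free_alg_ind (P : T -> Prop) :
  P 0 -> (forall a x y, P x -> P y -> P (a *: x + y)) ->
  (forall s, P (word s)) -> forall t, P t.
Proof.
move=> P0 PD Pw t; rewrite [t]free_algE.
by apply: big_rec => // m x _; apply: PD.
Qed.

Variables (R : algType k) (f : seq X -> R).

(** Here [f] need not be multiplicative: this is the linear extension from the basis of words, so
    derivations and degree projections can be obtained this way too. *)
Definition word_lift (t : T) : R :=
  mmap (in_alg R) (fun m : {fmonom X} => f m) (t : {malg k[{fmonom X}]}).

Lemma word_lift_word s : word_lift (word s) = f s.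
Proof. by rewrite /word_lift mmapU /= scale1r mul1r. Qed.

Lemma word_lift_word3 u s w :
  word_lift (word u * word s * word w) = f (u ++ s ++ w).
Proof. by rewrite word_cat3 word_lift_word. Qed.

Lemma word_lift_word4 u s t w :
  word_lift (word u * (word s * word t) * word w) = f (u ++ s ++ t ++ w).
Proof. by rewrite (catA s) -(word_lift_word3 u (s ++ t) w) (word_cat s t). Qed.

Fact word_lift_linear : linear word_lift.
Proof.
move=> a x y; rewrite /word_lift raddfD /=; congr (_ + _).
rewrite (mmapEw (msuppZ_le _ _)) mmapE scaler_sumr; apply: eq_bigr => m _.
by rewrite mcoeffZ /= -scalerA -scalerAl.
Qed.

HB.instance Definition _ :=
  GRing.isLinear.Build k T R *:%R word_lift word_lift_linear.

End FreeAlgebraLift.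

(* These facts, like most of what follows, are stated for an abstract algebra *)
(* because unification of two different products in [gsym] unfolds the        *)
(* multiplication of the quotient and diverges in practice.                   *)
Section Sandwich.
Variables (k : fieldType) (T R : algType k) (F : {linear T -> R}) (s : T).

Lemma sandwich_vanishl c a a' b :
  F (a * s * b) = 0 -> F (a' * s * b) = 0 -> F ((c *: a + a') * s * b) = 0.
Proof.
by move=> Fa Fa'; rewrite !mulrDl -!scalerAl linearP /= Fa Fa' scaler0 addr0.
Qed.

Lemma sandwich_vanishr c a b b' :
  F (a * s * b) = 0 -> F (a * s * b') = 0 -> F (a * s * (c *: b + b')) = 0.
Proof.
by move=> Fb Fb'; rewrite mulrDr -scalerAr linearP /= Fb Fb' scaler0 addr0.
Qed.

Lemma sandwich_relD c u w x y z p q r :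
  F (u * x * w) = p -> F (u * y * w) = q -> F (u * z * w) = r ->
  p = c *: q + r -> F (u * (x - (c *: y + z)) * w) = 0.
Proof.
move=> <- <- <- pE.
rewrite mulrBr mulrBl mulrDr mulrDl -scalerAr -scalerAl raddfB /= linearP.
by rewrite pE subrr.
Qed.

Lemma sandwich_relM c u w x y p q :
  F (u * x * w) = p -> F (u * y * w) = q -> p = c *: q ->
  F (u * (x - c *: y) * w) = 0.
Proof.
move=> <- <- pE.
by rewrite mulrBr mulrBl -scalerAr -scalerAl raddfB /= linearZ pE subrr.
Qed.

End Sandwich.

Section GradedSymmetricTheory.
Variables (k : fieldType) (I : choiceType) (deg : I -> int) (V : lmodType k).

Local Notation X := (I * V)%type.
Local Notation T := (free_alg k X).
Local Notation G := (gsym deg V).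
Local Notation B := (@gsym_deg k I deg V).
Local Notation gen := (gen deg).

Definition gword (s : seq X) : G := gsym_pi deg (word k s).
Definition sdeg (s : seq X) : int := \sum_(l <- s) deg l.1.

Lemma gsym_pi_linear : linear (@gsym_pi k I deg V).
Proof. exact: alg_pi_linear. Qed.

Lemma gsym_pi_monoid_morphism : monoid_morphism (@gsym_pi k I deg V).
Proof. exact: alg_pi_monoid_morphism. Qed.

HB.instance Definition _ :=
  GRing.isLinear.Build k T G *:%R (@gsym_pi k I deg V) gsym_pi_linear.
HB.instance Definition _ :=
  GRing.isMonoidMorphism.Build T G (@gsym_pi k I deg V) gsym_pi_monoid_morphism.

Lemma gword_nil : gword [::] = 1.
Proof. by rewrite /gword word_nil rmorph1. Qed.

Lemma gword_cat s t : gword (s ++ t) = gword s * gword t.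
Proof. by rewrite /gword word_cat rmorphM. Qed.

Lemma gword_cons i v s : gword ((i, v) :: s) = gen i v * gword s.
Proof. by rewrite -cat1s gword_cat /gword /Defs.gen letterE. Qed.

Lemma sdeg_nil : sdeg [::] = 0. Proof. exact: big_nil. Qed.

Lemma sdeg_cons i v s : sdeg ((i, v) :: s) = deg i + sdeg s.
Proof. exact: big_cons. Qed.

Lemma sdeg_cat s t : sdeg (s ++ t) = sdeg s + sdeg t.
Proof. exact: big_cat. Qed.

Lemma gen_linear i : linear (gen i : V -> G).
Proof.
move=> a v w; rewrite -gsym_pi_linear; apply/alg_piP.
by apply: ideal_gen_sub; apply: gsym_rel_lin.
Qed.

HB.instance Definition _ i :=
  GRing.isLinear.Build k V G *:%R (gen i) (gen_linear i).

Lemma gen_comm i v j w :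
  gen i v * gen j w = ksign (deg i * deg j) *: (gen j w * gen i v) :> G.
Proof.
rewrite /Defs.gen -!rmorphM -linearZ; apply/alg_piP.
by apply: ideal_gen_sub; apply: gsym_rel_comm.
Qed.

Lemma gsym_word_ind (P : G -> Prop) :
  P 0 -> (forall a x y, P x -> P y -> P (a *: x + y)) ->
  (forall s, P (gword s)) -> forall x, P x.
Proof.
move=> P0 PD Pw x; have [t ->] := alg_pi_surj x; rewrite -/(gsym_pi deg t).
elim/free_alg_ind: t => [|a t u Pt Pu|s]; last exact: Pw.
  by rewrite raddf0.
by rewrite linearP; exact: PD Pt Pu.
Qed.

Lemma gsym_deg_word_ind n (P : G -> Prop) :
  P 0 -> (forall a x y, P x -> P y -> P (a *: x + y)) ->
  (forall s, sdeg s = n -> P (gword s)) -> forall x, B n x -> P x.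
Proof.
move=> P0 PD Pw _ [t -> tn]; rewrite [t]free_algE.
rewrite raddf_sum big_seq.
apply: big_rec => // m x mt Px; rewrite /= linearZ; apply: PD => //.
by apply: Pw; rewrite -(tn m) // mcoeff_neq0.
Qed.

Lemma gsym_deg_word s : B (sdeg s) (gword s).
Proof.
exists (word k s) => // m; rewrite mcoeffU1; case: (FMonom s =P m) => [<- //|_].
by rewrite eqxx.
Qed.

Lemma gsym_deg0 n : B n 0.
Proof.
by exists 0 => [|m /eqP[]]; [rewrite raddf0 | exact: mcoeff0].
Qed.

Lemma gsym_degP n a x y : B n x -> B n y -> B n (a *: x + y).
Proof.
move=> [t -> tn] [u -> un]; exists (a *: t + u); first by rewrite linearP.
move=> m; rewrite mcoeffD mcoeffZ.
have [-> |nt] := eqVneq (mcoeff m (t : {malg k[_]})) 0; last by rewrite tn.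
by rewrite mulr0 add0r; apply: un.
Qed.

Lemma gsym_deg1 : B 0 1.
Proof. by rewrite -gword_nil -sdeg_nil; apply: gsym_deg_word. Qed.

Lemma gsym_degM m n x y : B m x -> B n y -> B (m + n) (x * y).
Proof.
move=> Bx By; move: x Bx; apply: gsym_deg_word_ind => [|a x x' Px Px'|s <-].
- by rewrite mul0r; apply: gsym_deg0.
- by rewrite mulrDl -scalerAl; exact: gsym_degP Px Px'.
move: y By; apply: gsym_deg_word_ind => [|a y y' Py Py'|s' <-].
- by rewrite mulr0; apply: gsym_deg0.
- by rewrite mulrDr -scalerAr; exact: gsym_degP Py Py'.
by rewrite -gword_cat -sdeg_cat; apply: gsym_deg_word.
Qed.

Lemma gword1 i v : gword [:: (i, v)] = gen i v.
Proof. by rewrite gword_cons gword_nil mulr1. Qed.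

Lemma gen_deg i v : B (deg i) (gen i v).
Proof.
have := gsym_deg_word [:: (i, v)].
by rewrite gword1 sdeg_cons sdeg_nil addr0.
Qed.

Lemma gsym_ind (P : G -> Prop) :
  P 0 -> (forall a x y, P x -> P y -> P (a *: x + y)) -> P 1 ->
  (forall n i v x, B n x -> P x -> P (gen i v * x)) -> forall x, P x.
Proof.
move=> P0 PD P1 Pg; apply: (gsym_word_ind P0 PD) => s.
elim: s => [|[i v] s IH]; first by rewrite gword_nil.
by rewrite gword_cons; apply: Pg (gsym_deg_word _) IH.
Qed.

Lemma gsym_deg_ind (P : int -> G -> Prop) :
  (forall n, P n 0) -> (forall n a x y, P n x -> P n y -> P n (a *: x + y)) ->
  P 0 1 ->
  (forall n i v x, B n x -> P n x -> P (deg i + n) (gen i v * x)) ->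
  forall n x, B n x -> P n x.
Proof.
move=> P0 PD P1 Pg n; apply: gsym_deg_word_ind => [||s <-];
  [exact: P0 | move=> a x y; exact: PD|].
elim: s => [|[i v] s IH]; first by rewrite gword_nil sdeg_nil.
by rewrite gword_cons sdeg_cons; apply: Pg (gsym_deg_word _) IH.
Qed.

Section WordLift.
Variables (R : algType k) (f : seq X -> R).
Hypothesis f_lin : forall u w i a v v',
  f (u ++ (i, a *: v + v') :: w) =
  a *: f (u ++ (i, v) :: w) + f (u ++ (i, v') :: w).
Hypothesis f_comm : forall u w i j v v',
  f (u ++ [:: (i, v), (j, v') & w]) =
  ksign (deg i * deg j) *: f (u ++ [:: (j, v'), (i, v) & w]).

(** By linearity the outer factors of a term of the ideal may be taken to be words, and the relation
    between them is then an instance of [f_lin] or [f_comm]. *)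
Lemma word_lift_ideal t : ideal_gen (gsym_rel deg (V := V)) t ->
  word_lift f t = 0.
Proof.
elim=> [|a s b x rs _ IH]; first exact: raddf0.
rewrite raddfD /= IH addr0.
elim/free_alg_ind: a => [|c a a' Pa Pa'|u].
- by rewrite !mul0r raddf0.
- exact: sandwich_vanishl Pa Pa'.
elim/free_alg_ind: b => [|c b b' Pb Pb'|w].
- by rewrite !mulr0 raddf0.
- exact: sandwich_vanishr Pb Pb'.
case: rs => [i c v v'|i j v v']; rewrite !letterE.
  by apply: sandwich_relD; try exact: word_lift_word3; apply: f_lin.
by apply: sandwich_relM; try exact: word_lift_word4; apply: f_comm.
Qed.

(** The universal property at the level of vector spaces: a linear map out of $S^\bullet(U)$ is a
    function of words, multilinear in the letters and graded symmetric. *)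
Lemma gsym_word_lift : exists g : {linear G -> R}, forall s, g (gword s) = f s.
Proof.
pose g (x : G) : R := word_lift f (repr x).
have gE t : g (gsym_pi deg t) = word_lift f t.
  apply/eqP; rewrite -subr_eq0 -raddfB; apply/eqP.
  exact/word_lift_ideal/alg_repr.
have g_lin : linear g.
  move=> a x y; have [t ->] := alg_pi_surj x; have [u ->] := alg_pi_surj y.
  by rewrite -[alg_pi t]/(gsym_pi deg t) -[alg_pi u]/(gsym_pi deg u)
    -gsym_pi_linear !gE linearP.
pose gL := GRing.isLinear.Build k G R *:%R g g_lin.
pose g' : {linear G -> R} := HB.pack g gL.
exists g' => s; rewrite /g' /=.
by rewrite gE word_lift_word.
Qed.

End WordLift.

End GradedSymmetricTheory.

(** * Koszul signs, decided by parities *)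

Section KoszulSign.
Variable k : fieldType.

Definition parity (n : int) : bool := odd `|n|%N.

Lemma parityD m n : parity (m + n) = parity m (+) parity n.
Proof.
have parB (a b : nat) : parity (a%:Z - b%:Z) = odd a (+) odd b.
  rewrite /parity; case: (leqP b a) => [ba|/ltnW ab].
    by rewrite distnEl // oddB.
  by rewrite distnEr // oddB // addbC.
case: m n => m [] n.
- by rewrite /parity -PoszD !absz_nat oddD.
- by rewrite NegzE parB /parity abszN !absz_nat.
- by rewrite NegzE addrC parB /parity abszN !absz_nat addbC.
- by rewrite !NegzE /parity -opprD !abszN -PoszD !absz_nat oddD.
Qed.

Lemma parityM m n : parity (m * n) = parity m && parity n.
Proof. by rewrite /parity abszM oddM. Qed.

Lemma parityN n : parity (- n) = parity n.
Proof. by rewrite /parity abszN. Qed.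

Lemma parity0 : parity 0 = false. Proof. by []. Qed.

Lemma parity1 : parity 1 = true. Proof. by []. Qed.

Lemma parity_nat (n : nat) : parity n%:Z = odd n. Proof. by []. Qed.

Lemma ksign_parity n : ksign n = (-1) ^+ parity n :> k.
Proof. by rewrite /ksign /parity signr_odd. Qed.

End KoszulSign.

Lemma eq_signr (k : fieldType) (b c : bool) :
  b = c -> (-1) ^+ b = (-1) ^+ c :> k.
Proof. by move->. Qed.

Ltac parity_cases :=
  repeat match goal with
  | |- context [parity ?n] => case: (parity n)
  | |- context [odd ?n] => case: (odd n)
  end.

Ltac ksign_ring :=
  rewrite ?(mulr0, mulr1, mul1r, addr0, add0r, oppr0);
  first [done |
  rewrite ?ksign_parity
    ?(parityD, parityM, parityN, parity0, parity1, parity_nat, oddD, oddS);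
  first [
    rewrite ?mulrN ?mulNr ?opprK ?mulrA -?signr_addb -?signrN -?signr_addb;
    apply: eq_signr; parity_cases; reflexivity |
  parity_cases;
  rewrite /= ?(expr0, expr1, mulN1r, mul1r, mulr1, mulrN1, mulrN, mulNr, opprK);
  first [done | ring]]].

(** * Identities between linear combinations, by reflection *)

Section LinearCombination.
Variables (k : comPzRingType) (M : lmodType k).

Inductive lexp :=
| LVar of nat | LZero | LAdd of lexp & lexp | LOpp of lexp | LScale of k & lexp.

Fixpoint leval (env : seq M) (e : lexp) : M :=
  match e with
  | LVar i => nth 0 env i
  | LZero => 0
  | LAdd e1 e2 => leval env e1 + leval env e2
  | LOpp e1 => - leval env e1
  | LScale c e1 => c *: leval env e1
  end.

Fixpoint lcoef (e : lexp) (i : nat) : k :=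
  match e with
  | LVar j => if eqn j i then 1 else 0
  | LZero => 0
  | LAdd e1 e2 => lcoef e1 i + lcoef e2 i
  | LOpp e1 => - lcoef e1 i
  | LScale c e1 => c * lcoef e1 i
  end.

Fixpoint same_lcoefs (e1 e2 : lexp) (n : nat) : Prop :=
  if n is n'.+1 then lcoef e1 n' = lcoef e2 n' /\ same_lcoefs e1 e2 n'
  else True.

Lemma levalE env e : leval env e = \sum_(i < size env) lcoef e i *: nth 0 env i.
Proof.
elim: e => [j||e1 IH1 e2 IH2|e IH|c e IH] /=.
- have [j_lt|j_ge] := ltnP j (size env).
    rewrite (bigD1 (Ordinal j_lt)) //= eqnE eqxx scale1r big1 ?addr0 // => i ij.
    by rewrite eq_sym [_ == _](negPf ij) scale0r.
  rewrite nth_default // big1 // => i _; rewrite eqnE.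
  by rewrite gtn_eqF ?scale0r ?(leq_trans (ltn_ord i)).
- by rewrite big1 // => i _; rewrite scale0r.
- by rewrite IH1 IH2 -big_split; apply: eq_bigr => i _; rewrite scalerDl.
- by rewrite IH -sumrN; apply: eq_bigr => i _; rewrite scaleNr.
- by rewrite IH scaler_sumr; apply: eq_bigr => i _; rewrite scalerA.
Qed.

(** Soundness of the reflection: equal coefficients suffice, whatever relations hold between the
    atoms. *)
Lemma eq_lcoefs env e1 e2 :
  same_lcoefs e1 e2 (size env) -> leval env e1 = leval env e2.
Proof.
move=> eq12; rewrite !levalE; apply: eq_bigr => i _; congr (_ *: _).
move: (i : nat) (ltn_ord i) => j; elim: (size env) eq12 => //= n IH [eqn eq12].
by rewrite ltnS leq_eqVlt => /predU1P[-> //|]; apply: IH.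
Qed.

End LinearCombination.

(* [lcomb] proves an equality of linear combinations in a module: it leaves   *)
(* the equalities of the coefficients of each atom.                           *)
Ltac lcomb_mem x l :=
  lazymatch l with
  | nil => false
  | cons ?y ?l' => let b := match constr:(Set) with
      | _ => let _ := match constr:(Set) with _ => constr_eq x y end in true
      | _ => lcomb_mem x l' end in b
  end.

Ltac lcomb_index x l :=
  lazymatch l with
  | cons ?y ?l' => match constr:(Set) with
      | _ => let _ := match constr:(Set) with _ => constr_eq x y end in
             constr:(O)
      | _ => let n := lcomb_index x l' in constr:(S n) end
  end.

Ltac lcomb_atoms t l :=
  lazymatch t with
  | @Algebra.zero _ => l
  | @Algebra.add _ ?a ?b => let l' := lcomb_atoms a l in lcomb_atoms b l'
  | @Algebra.opp _ ?a => lcomb_atoms a l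
  | @GRing.scale _ _ _ ?a => lcomb_atoms a l
  | _ => lazymatch lcomb_mem t l with
         | true => l
         | false => constr:(cons t l)
         end
  end.

Ltac lcomb_reify k t l :=
  lazymatch t with
  | @Algebra.zero _ => constr:(@LZero k)
  | @Algebra.add _ ?a ?b =>
      let u := lcomb_reify k a l in let v := lcomb_reify k b l in
      constr:(@LAdd k u v)
  | @Algebra.opp _ ?a => let u := lcomb_reify k a l in constr:(@LOpp k u)
  | @GRing.scale _ _ ?c ?a =>
      let u := lcomb_reify k a l in constr:(@LScale k c u)
  | _ => let i := lcomb_index t l in constr:(@LVar k i)
  end.

Ltac lcomb_in k M :=
  lazymatch goal with
  | |- @eq ?T ?x ?y =>
    let l := lcomb_atoms x (@nil T) in
    let l := lcomb_atoms y l in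
    let u := lcomb_reify k x l in
    let v := lcomb_reify k y l in
    refine (@eq_lcoefs k M l u v _); cbn [same_lcoefs lcoef size eqn];
    repeat split
  end.

Ltac lcomb :=
  lazymatch goal with
  | |- context [@GRing.scale ?k ?M _ _] => lcomb_in k M
  end.

(* Distributivity restated over an [algType], so that rewriting produces      *)
(* syntactically equal products, which [lcomb] recognizes as the same atom.   *)
Section AlgebraNormalForm.
Variables (k : fieldType) (A : algType k).
Implicit Types (c : k) (x y z : A).

Lemma alg_mulDl x y z : (x + y) * z = x * z + y * z.
Proof. exact: mulrDl. Qed.

Lemma alg_mulDr x y z : x * (y + z) = x * y + x * z.
Proof. exact: mulrDr. Qed.

Lemma alg_mulNl x y : - x * y = - (x * y).
Proof. exact: mulNr. Qed.

Lemma alg_mulNr x y : x * - y = - (x * y).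
Proof. exact: mulrN. Qed.

Lemma alg_mulZl c x y : (c *: x) * y = c *: (x * y).
Proof. by rewrite scalerAl. Qed.

Lemma alg_mulZr c x y : x * (c *: y) = c *: (x * y).
Proof. by rewrite scalerAr. Qed.

Lemma alg_mulA x y z : x * (y * z) = x * y * z.
Proof. exact: mulrA. Qed.

End AlgebraNormalForm.

Ltac alg_norm := rewrite ?(alg_mulZl, alg_mulZr, alg_mulDl, alg_mulDr,
  alg_mulNl, alg_mulNr, alg_mulA, mulr0, mul0r).

(** * Derivations and degree projections on words *)

Section DerivationOnWords.
Variables (k : fieldType) (I : choiceType) (deg : I -> int) (V : lmodType k).
Variables (A : algType k) (gen : I -> V -> A) (gw : seq (I * V) -> A).

Local Notation X := (I * V)%type.

Hypothesis gw_nil : gw [::] = 1.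
Hypothesis gw_cons : forall i v s, gw ((i, v) :: s) = gen i v * gw s.
Hypothesis gen_lin : forall i, linear (gen i).
Hypothesis gen_comm : forall i v j w,
  gen i v * gen j w = ksign (deg i * deg j) *: (gen j w * gen i v).

Local Notation sdeg := (sdeg deg).

Lemma gw_cat s t : gw (s ++ t) = gw s * gw t.
Proof.
elim: s => [|[i v] s IH]; first by rewrite gw_nil mul1r.
by rewrite cat_cons !gw_cons IH mulrA.
Qed.

Lemma gen_gw_comm i v s :
  gen i v * gw s = ksign (deg i * sdeg s) *: (gw s * gen i v).
Proof.
elim: s => [|[j w] s IH].
  by rewrite gw_nil mulr1 mul1r sdeg_nil mulr0 /ksign expr0 scale1r.
rewrite gw_cons mulrA gen_comm -scalerAl -[in LHS]mulrA IH.
rewrite -scalerAr scalerA mulrA.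
by rewrite sdeg_cons; congr (_ *: _); ksign_ring.
Qed.

Lemma gw_comm s t : gw s * gw t = ksign (sdeg s * sdeg t) *: (gw t * gw s).
Proof.
elim: s => [|[i v] s IH].
  by rewrite gw_nil mulr1 mul1r sdeg_nil mul0r /ksign expr0 scale1r.
rewrite gw_cons sdeg_cons -[in LHS]mulrA IH; alg_norm.
by rewrite gen_gw_comm; alg_norm; lcomb; ksign_ring.
Qed.

Variables (m : int) (delta : I -> V -> A).
Hypothesis delta_lin : forall i, linear (delta i).

(* The derivation of degree m extending delta, with its values moved to the   *)
(* right of each product. In this form delta need not be homogeneous, so that *)
(* x |-> {x, y} is also of this type (with m = 0), for any y.                 *)
Fixpoint der_word (s : seq X) : A :=
  if s is (i, v) :: s' then
    ksign (m * deg i) *: (gen i v * der_word s') +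
    ksign (sdeg s' * (m + deg i)) *: (gw s' * delta i v)
  else 0.

Lemma der_word_cons i v s : der_word ((i, v) :: s) =
  ksign (m * deg i) *: (gen i v * der_word s) +
  ksign (sdeg s * (m + deg i)) *: (gw s * delta i v).
Proof. by []. Qed.

(** The Leibniz rule for words. It also reduces linearity and graded symmetry of [der_word] at an
    arbitrary place of a word to the head of the word. *)
Lemma der_word_cat s t : der_word (s ++ t) =
  ksign (m * sdeg s) *: (gw s * der_word t) +
  ksign (sdeg t * (m + sdeg s)) *: (gw t * der_word s).
Proof.
elim: s => [|[i v] s IH].
  rewrite gw_nil mul1r mulr0 scaler0 addr0 sdeg_nil mulr0.
  by rewrite /ksign expr0 scale1r.
rewrite cat_cons !der_word_cons IH gw_cat !gw_cons sdeg_cat sdeg_cons.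
alg_norm; rewrite [gen i v * gw t]gen_gw_comm [gw s * gw t]gw_comm; alg_norm.
by lcomb; ksign_ring.
Qed.

Lemma gw_lin u w i a v v' :
  gw (u ++ (i, a *: v + v') :: w) =
  a *: gw (u ++ (i, v) :: w) + gw (u ++ (i, v') :: w).
Proof.
by rewrite !gw_cat !gw_cons gen_lin mulrDl mulrDr -scalerAl -scalerAr.
Qed.

Lemma gw_swap u w i j v v' :
  gw (u ++ [:: (i, v), (j, v') & w]) =
  ksign (deg i * deg j) *: gw (u ++ [:: (j, v'), (i, v) & w]).
Proof.
by rewrite !gw_cat !gw_cons [_ * (_ * gw w)]mulrA gen_comm; alg_norm.
Qed.

Lemma der_word_lin u w i a v v' :
  der_word (u ++ (i, a *: v + v') :: w) =
  a *: der_word (u ++ (i, v) :: w) + der_word (u ++ (i, v') :: w).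
Proof.
have lin1 : der_word ((i, a *: v + v') :: w) =
    a *: der_word ((i, v) :: w) + der_word ((i, v') :: w).
  by rewrite !der_word_cons gen_lin delta_lin; alg_norm; lcomb; ksign_ring.
rewrite !der_word_cat lin1 (gw_lin [::]) /= !sdeg_cons; alg_norm.
by lcomb; ksign_ring.
Qed.

Lemma der_word_swap u w i j v v' :
  der_word (u ++ [:: (i, v), (j, v') & w]) =
  ksign (deg i * deg j) *: der_word (u ++ [:: (j, v'), (i, v) & w]).
Proof.
have swap1 : der_word [:: (i, v), (j, v') & w] =
    ksign (deg i * deg j) *: der_word [:: (j, v'), (i, v) & w].
  rewrite !der_word_cons !gw_cons !sdeg_cons; alg_norm.
  rewrite gen_comm !gen_gw_comm; alg_norm.
  by lcomb; ksign_ring.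
rewrite !der_word_cat swap1 (gw_swap [::]) !sdeg_cons.
move: (der_word (_ :: _)) (gw (_ :: _)) => x y.
by alg_norm; lcomb; ksign_ring.
Qed.

Variable n : int.

(** These projections respect the defining relations, which is why the homogeneous parts of the
    quotient are in direct sum. *)
Definition proj_word (s : seq X) : A := if sdeg s == n then gw s else 0.

Lemma proj_word_lin u w i a v v' :
  proj_word (u ++ (i, a *: v + v') :: w) =
  a *: proj_word (u ++ (i, v) :: w) + proj_word (u ++ (i, v') :: w).
Proof.
rewrite /proj_word !sdeg_cat !sdeg_cons; case: ifP => _; first exact: gw_lin.
by rewrite scaler0 addr0.
Qed.

Lemma proj_word_swap u w i j v v' :
  proj_word (u ++ [:: (i, v), (j, v') & w]) =
  ksign (deg i * deg j) *: proj_word (u ++ [:: (j, v'), (i, v) & w]).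
Proof.
rewrite /proj_word !sdeg_cat !sdeg_cons [deg i + (deg j + _)]addrCA.
by case: ifP => _; rewrite ?scaler0 // gw_swap.
Qed.

End DerivationOnWords.

Section BilinearExtension.
Variables (k : fieldType) (A : algType k).

Lemma twisted_leibniz_lin (D : {linear A -> A}) (e1 e2 a : k) (x x' y : A) :
  D (x * y) = e1 *: (x * D y) + e2 *: (y * D x) ->
  D (x' * y) = e1 *: (x' * D y) + e2 *: (y * D x') ->
  D ((a *: x + x') * y) =
  e1 *: ((a *: x + x') * D y) + e2 *: (y * D (a *: x + x')).
Proof.
move=> xE x'E; rewrite !linearP /=; alg_norm; rewrite linearP /= xE x'E.
alg_norm.
by lcomb; ring.
Qed.

Lemma twisted_leibniz_linr (D : {linear A -> A}) (e1 e2 a : k) (x y y' : A) :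
  D (x * y) = e1 *: (x * D y) + e2 *: (y * D x) ->
  D (x * y') = e1 *: (x * D y') + e2 *: (y' * D x) ->
  D (x * (a *: y + y')) =
  e1 *: (x * D (a *: y + y')) + e2 *: ((a *: y + y') * D x).
Proof.
move=> xE x'E; rewrite !linearP /=; alg_norm; rewrite linearP /= xE x'E.
alg_norm.
by lcomb; ring.
Qed.

Lemma twisted_comm_lin (e a : k) (x x' y : A) :
  x * y = e *: (y * x) -> x' * y = e *: (y * x') ->
  (a *: x + x') * y = e *: (y * (a *: x + x')).
Proof. by alg_norm => -> ->; lcomb; ring. Qed.

Lemma twisted_comm_linr (e a : k) (x y y' : A) :
  x * y = e *: (y * x) -> x * y' = e *: (y' * x) ->
  x * (a *: y + y') = e *: ((a *: y + y') * x).
Proof. by alg_norm => -> ->; lcomb; ring. Qed.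

End BilinearExtension.

(** * Gradings recovered from projections *)

Section GradedFromProjections.
Variables (k : fieldType) (A : algType k) (B : int -> A -> Prop).
Variable proj : int -> {linear A -> A}.

Hypothesis B0 : forall n, B n 0.
Hypothesis BP : forall n a x y, B n x -> B n y -> B n (a *: x + y).
Hypothesis B1 : B 0 1.
Hypothesis BM : forall m n x y, B m x -> B n y -> B (m + n) (x * y).
Hypothesis B_ind : forall P : A -> Prop, P 0 ->
  (forall a x y, P x -> P y -> P (a *: x + y)) ->
  (forall n x, B n x -> P x) -> forall x, P x.
Hypothesis proj_deg : forall n x, B n (proj n x).
Hypothesis projE : forall m n x, B m x -> proj n x = if m == n then x else 0.

Lemma graded_from_proj : is_graded_algebra B.
Proof.
split=> //.
(* The claim covers every duplicate-free list containing [s], so that the lists found for two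
   summands can be merged. *)
- suff ex_s x : exists s : seq int, forall s', uniq s' -> {subset s <= s'} ->
      x = \sum_(n <- s') proj n x.
    move=> x; have [s xE] := ex_s x; exists (undup s), (proj^~ x).
    by split=> //; apply: xE; rewrite ?undup_uniq // => n; rewrite mem_undup.
  move: x; apply: B_ind => [|a x y [s xE] [t yE]|n x Bx].
  + by exists [::] => s' _ _; rewrite big1 // => n _; rewrite linear0.
  + exists (s ++ t) => s' s'_uniq sub.
    have sub_s : {subset s <= s'} by move=> n ns; apply: sub; rewrite mem_cat ns.
    have sub_t : {subset t <= s'}.
      by move=> n nt; apply: sub; rewrite mem_cat nt orbT.
    rewrite {1}(xE s' s'_uniq sub_s) {1}(yE s' s'_uniq sub_t).
    by rewrite scaler_sumr -big_split; apply: eq_bigr => n _; rewrite linearP.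
  + exists [:: n] => s' s'_uniq sub.
    rewrite (bigD1_seq n) ?sub ?inE //= (projE _ Bx) eqxx big1 ?addr0 // => i ni.
    by rewrite (projE _ Bx) eq_sym (negPf ni).
- move=> s f s_uniq fB f0 n ns.
  have := congr1 (proj n) f0; rewrite linear0 linear_sum (bigD1_seq n) //=.
  rewrite (projE _ (fB n)) eqxx big1 ?addr0 // => i ni.
  by rewrite (projE _ (fB i)) (negPf ni).
Qed.

End GradedFromProjections.

(** The interface through which later proofs see [gsym]. In [fg_der] the factor [D x] stands to the
    right of [y]: moving it to the usual place requires it to be homogeneous, as in
    [der_leibniz]. *)
Record is_free_gcomm (k : fieldType) (I : choiceType) (deg : I -> int)
    (V : lmodType k) (A : algType k) (B : int -> A -> Prop)
    (gen : I -> V -> A) : Prop := IsFreeGComm {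
  fg_graded : is_graded_algebra B;
  fg_comm : is_graded_commutative B;
  fg_lin : forall i, linear (gen i);
  fg_deg : forall i v, B (deg i) (gen i v);
  fg_ind : forall P : A -> Prop,
    P 0 -> (forall a x y, P x -> P y -> P (a *: x + y)) -> P 1 ->
    (forall n i v x, B n x -> P x -> P (gen i v * x)) -> forall x, P x;
  fg_deg_ind : forall P : int -> A -> Prop,
    (forall n, P n 0) ->
    (forall n a x y, P n x -> P n y -> P n (a *: x + y)) -> P 0 1 ->
    (forall n i v x, B n x -> P n x -> P (deg i + n) (gen i v * x)) ->
    forall n x, B n x -> P n x;
  fg_der : forall (m : int) (delta : I -> V -> A),
    (forall i, linear (delta i)) ->
    exists D : {linear A -> A}, [/\ D 1 = 0,
      forall i v, D (gen i v) = delta i v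
    & forall p q x y, B p x -> B q y ->
      D (x * y) =
      ksign (m * p) *: (x * D y) + ksign (q * (m + p)) *: (y * D x)] }.

Section GsymFree.
Variables (k : fieldType) (I : choiceType) (deg : I -> int) (V : lmodType k).

Local Notation G := (gsym deg V).
Local Notation B := (@gsym_deg k I deg V).
Local Notation gen := (@gen k I deg V).
Local Notation gword := (@gword k I deg V).

Lemma gword_comm s t :
  gword s * gword t = ksign (sdeg deg s * sdeg deg t) *: (gword t * gword s).
Proof.
exact: (gw_comm (gword_nil deg V) (@gword_cons k I deg V) (@gen_comm k I deg V)).
Qed.

Lemma gsym_comm : is_graded_commutative B.
Proof.
move=> m n x y Bx By; move: x Bx.
apply: gsym_deg_word_ind => [|a x x' Px Px'|s <-].
- by rewrite mul0r mulr0 scaler0.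
- exact: twisted_comm_lin Px Px'.
move: y By; apply: gsym_deg_word_ind => [|a y y' Py Py'|t <-].
- by rewrite mul0r mulr0 scaler0.
- exact: twisted_comm_linr Py Py'.
exact: gword_comm.
Qed.

Lemma gsym_proj n : exists p : {linear G -> G},
  forall s, p (gword s) = proj_word deg gword n s.
Proof.
have gn := gword_nil deg V; have gc := @gword_cons k I deg V.
have gl := @gen_linear k I deg V; have gcm := @gen_comm k I deg V.
exact: gsym_word_lift (proj_word_lin deg gn gc gl n) (proj_word_swap gn gc gcm n).
Qed.

Lemma gsym_graded : is_graded_algebra B.
Proof.
have /choice[proj projE] := gsym_proj.
apply: (@graded_from_proj k G B proj).
- exact: gsym_deg0.
- exact: gsym_degP.
- exact: gsym_deg1.
- exact: gsym_degM.
- move=> P P0 PD PB; apply: (gsym_word_ind P0 PD) => s.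
  exact: PB _ _ (gsym_deg_word deg s).
- move=> n; apply: gsym_word_ind => [|a x y Px Py|s].
  + by rewrite linear0; exact: gsym_deg0.
  + by rewrite linearP; exact: gsym_degP Px Py.
  rewrite projE /proj_word; case: eqP => [<-|_]; [exact: gsym_deg_word|].
  exact: gsym_deg0.
- move=> m n; apply: gsym_deg_word_ind => [|a x y Px Py|s sm].
  + by rewrite linear0; case: ifP.
  + rewrite linearP Px Py; case: ifP => // _.
    by rewrite scaler0 addr0.
  by rewrite projE /proj_word sm.
Qed.

Lemma gsym_free : is_free_gcomm deg B gen.
Proof.
split.
- exact: gsym_graded.
- exact: gsym_comm.
- exact: gen_linear.
- exact: gen_deg.
- exact: gsym_ind.
- exact: gsym_deg_ind.
move=> m delta delta_lin.
have gn := gword_nil deg V; have gc := @gword_cons k I deg V.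
have gl := @gen_linear k I deg V; have gcm := @gen_comm k I deg V.
have [D DE] := gsym_word_lift (der_word_lin gn gc gl gcm m delta_lin)
  (der_word_swap gn gc gcm m delta).
exists D; split.
- by rewrite -[1]gn DE.
- move=> i v; rewrite -gword1 DE der_word_cons gn mul1r sdeg_nil mul0r.
  by rewrite mulr0 scaler0 add0r /ksign expr0 scale1r.
move=> p q x y Bx By; move: x Bx.
apply: gsym_deg_word_ind => [|a x x' Px Px'|s <-].
- by rewrite !mul0r linear0 mulr0 !scaler0 addr0.
- exact: twisted_leibniz_lin Px Px'.
move: y By; apply: gsym_deg_word_ind => [|a y y' Py Py'|t <-].
- by rewrite !mulr0 linear0 mulr0 mul0r !scaler0 addr0.
- exact: twisted_leibniz_linr Py Py'.
rewrite -gword_cat !DE; exact: der_word_cat.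
Qed.

End GsymFree.

(** * Derivations and brackets determined by generators *)

(** A graded Poisson bracket short of the Jacobi identity: what extension from generators
    provides. *)
Record is_graded_biderivation (k : fieldType) (A : algType k)
    (B : int -> A -> Prop) (br : A -> A -> A) : Prop := IsGradedBiderivation {
  bd_linear : forall x, linear (br x);
  bd_linearl : forall y, linear (br^~ y);
  bd_deg : forall m n x y, B m x -> B n y -> B (m + n) (br x y);
  bd_anti : forall m n x y, B m x -> B n y ->
    br x y = - ksign (m * n) *: br y x;
  bd_leibniz : forall m n x y z, B m x -> B n y ->
    br x (y * z) = br x y * z + ksign (m * n) *: (y * br x z) }.

Section FreeGComm.
Variables (k : fieldType) (I : choiceType) (deg : I -> int) (V : lmodType k).
Variables (A : algType k) (B : int -> A -> Prop) (gen : I -> V -> A).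
Hypothesis fg : is_free_gcomm deg B gen.

Let gA := fg_graded fg.
Let comm := fg_comm fg.

Lemma homog_ind (P : A -> Prop) :
  P 0 -> (forall a x y, P x -> P y -> P (a *: x + y)) ->
  (forall n x, B n x -> P x) -> forall x, P x.
Proof.
move=> P0 PD PB x; have [s [f [fB ->]]] := graded_span gA x.
elim/big_rec: _ => // n y _ Py; rewrite -[f n]scale1r.
by apply: PD => //; apply: PB (fB n).
Qed.

Lemma homogZ n a x : B n x -> B n (a *: x).
Proof.
move=> Bx; rewrite -[_ *: _]addr0; apply: (gradedP gA) => //.
exact: (graded0 gA).
Qed.

Lemma homogD n x y : B n x -> B n y -> B n (x + y).
Proof. by move=> Bx By; rewrite -[x]scale1r; apply: (gradedP gA). Qed.

Section Derivations.
Variables (m : int) (D : {linear A -> A}).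
Hypothesis D1 : D 1 = 0.
Hypothesis DM : forall p q x y, B p x -> B q y ->
  D (x * y) = ksign (m * p) *: (x * D y) + ksign (q * (m + p)) *: (y * D x).
Hypothesis Dgen : forall i v, B (m + deg i) (D (gen i v)).

Lemma der_deg p x : B p x -> B (m + p) (D x).
Proof.
move: p x; apply: (fg_deg_ind fg) => [n|n a x y Dx Dy||n i v x Bx Dx].
- by rewrite linear0; apply: (graded0 gA).
- by rewrite linearP; apply: (gradedP gA).
- by rewrite D1; apply: (graded0 gA).
rewrite (DM (fg_deg fg i v) Bx); apply: homogD; apply: homogZ.
  by rewrite addrCA; apply: (gradedM gA) => //; apply: (fg_deg fg).
by rewrite addrA [_ + n]addrC; apply: (gradedM gA).
Qed.

Lemma der_leibniz p x y : B p x ->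
  D (x * y) = D x * y + ksign (m * p) *: (x * D y).
Proof.
move=> Bx; move: y; apply: homog_ind => [|a y z Dy Dz|q y By].
- by rewrite !(mulr0, linear0, scaler0, addr0).
- rewrite !linearP /=; alg_norm; rewrite linearP /= Dy Dz.
  by alg_norm; lcomb; ring.
by rewrite (DM Bx By) (comm By (der_deg Bx)) scalerA addrC; lcomb; ksign_ring.
Qed.

End Derivations.

Lemma free_diff (delta : I -> V -> A) :
  (forall i, linear (delta i)) -> (forall i v, B (deg i + 1) (delta i v)) ->
  exists d : A -> A, [/\ linear d, forall i v, d (gen i v) = delta i v,
    forall n x, B n x -> B (n + 1) (d x), d 1 = 0 &
    forall n x y, B n x -> d (x * y) = d x * y + ksign n *: (x * d y)].
Proof.
move=> dlin ddeg; have [D [D1 Dg DM]] := fg_der fg 1 dlin.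
have Dd i v : B (1 + deg i) (D (gen i v)) by rewrite Dg addrC.
exists D; split=> //; first exact: linearP.
- by move=> n x Bx; rewrite addrC; apply: (der_deg D1 DM Dd).
- by move=> n x y Bx; rewrite (der_leibniz D1 DM Dd _ Bx) mul1r.
Qed.

Section Bracket.
Variable beta : I -> V -> I -> V -> A.
Hypothesis beta_linr : forall i v j, linear (beta i v j).
Hypothesis beta_linl : forall i j w, linear (fun v => beta i v j w).
Hypothesis beta_deg : forall i v j w, B (deg i + deg j) (beta i v j w).
Hypothesis beta_anti : forall i v j w,
  beta i v j w = - ksign (deg i * deg j) *: beta j w i v.

(** First of two stages in building the bracket: [ad i v] is the derivation
    $x\mapsto\{\mathrm{gen}\,i\,v,x\}$. *)
Lemma free_ad : exists ad : I -> V -> A -> A, forall i v,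
  [/\ linear (ad i v), ad i v 1 = 0, forall j w, ad i v (gen j w) = beta i v j w,
      forall p x, B p x -> B (deg i + p) (ad i v x) &
      forall p x y, B p x ->
        ad i v (x * y) = ad i v x * y + ksign (deg i * p) *: (x * ad i v y)].
Proof.
have ex_ad (iv : I * V) : exists D : A -> A,
  [/\ linear D, D 1 = 0, forall j w, D (gen j w) = beta iv.1 iv.2 j w,
      forall p x, B p x -> B (deg iv.1 + p) (D x) &
      forall p x y, B p x ->
        D (x * y) = D x * y + ksign (deg iv.1 * p) *: (x * D y)].
  have [D [D1 Dg DM]] := fg_der fg (deg iv.1) (@beta_linr iv.1 iv.2).
  have Dd j w : B (deg iv.1 + deg j) (D (gen j w)) by rewrite Dg.
  exists D; split=> //; first exact: linearP.
  - exact: (der_deg D1 DM Dd).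
  - by move=> p x y; apply: (der_leibniz D1 DM Dd).
have [f fP] := choice ex_ad.
by exists (fun i v => f (i, v)) => i v; apply: fP (i, v).
Qed.

Lemma free_bracket : exists2 br : A -> A -> A, is_graded_biderivation B br &
  forall i v j w, br (gen i v) (gen j w) = beta i v j w.
Proof.
have [ad adP] := free_ad.
have ad1 i v : ad i v 1 = 0 by case: (adP i v).
have adg i v j w : ad i v (gen j w) = beta i v j w by case: (adP i v).
have ad_deg i v p x : B p x -> B (deg i + p) (ad i v x).
  by case: (adP i v) => _ _ _ + _; apply.
have adM i v p x y : B p x ->
    ad i v (x * y) = ad i v x * y + ksign (deg i * p) *: (x * ad i v y).
  by case: (adP i v) => _ _ _ _; apply.
have adlin i v : linear (ad i v) by case: (adP i v).
pose adL i v : {linear A -> A} :=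
  HB.pack (ad i v) (GRing.isLinear.Build k A A *:%R (ad i v) (adlin i v)).
have ad0 i v : ad i v 0 = 0 := linear0 (adL i v).
have ad_linl y i : linear (fun v => ad i v y).
  move=> a v w /=; move: y; apply: (fg_ind fg) => [|b x y Px Py||n j u x Bx Px].
  - by rewrite !ad0 scaler0 addr0.
  - by rewrite !adlin Px Py; lcomb; ring.
  - by rewrite !ad1 scaler0 addr0.
  by rewrite !(adM _ _ _ _ _ (fg_deg fg j u)) Px !adg beta_linl; alg_norm;
    lcomb; ring.
(* Second stage: for fixed [y], not assumed homogeneous, $x\mapsto\{x,y\}$ extends $v\mapsto$
   [ad i v y]. *)
have [br brP] := choice (fun y => fg_der fg 0 (ad_linl y)).
pose br' x y := br y x.
have brl y : linear (br'^~ y) by move=> a x x'; rewrite /br' linearP.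
have br0l y : br' 0 y = 0 by rewrite /br' linear0.
have br1l y : br' 1 y = 0 by case: (brP y) => + _ _; apply.
have brg i v y : br' (gen i v) y = ad i v y by case: (brP y) => _ + _; apply.
have brMl p q x y z : B p x -> B q y ->
    br' (x * y) z = x * br' y z + ksign (p * q) *: (y * br' x z).
  move=> Bx By; case: (brP z) => _ _ /(_ p q x y Bx By).
  by rewrite mul0r add0r /ksign expr0 scale1r mulrC.
move: (br') brl br0l br1l brg brMl => {br brP br'} br brl br0l br1l brg brMl.
have br_deg m n x y : B m x -> B n y -> B (m + n) (br x y).
  move=> Bx By; move: m x Bx.
  apply: (fg_deg_ind fg) => [m|m a x x' Dx Dy||m i v x Bx Dx].
  - by rewrite br0l; apply: (graded0 gA).
  - by rewrite brl; apply: (gradedP gA).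
  - by rewrite br1l; apply: (graded0 gA).
  rewrite (brMl _ _ _ _ _ (fg_deg fg i v) Bx).
  apply: homogD; last apply: homogZ.
    by rewrite -addrA; apply: (gradedM gA) => //; apply: (fg_deg fg).
  rewrite [deg i + m]addrC -addrA; apply: (gradedM gA) => //.
  by rewrite brg; apply: ad_deg.
have brr x : linear (br x).
  move=> a y z; move: x; apply: (fg_ind fg) => [|b x x' Px Px'||n j u x Bx Px].
  - by rewrite !br0l scaler0 addr0.
  - by rewrite !brl Px Px'; lcomb; ring.
  - by rewrite !br1l scaler0 addr0.
  rewrite !(brMl _ _ _ _ _ (fg_deg fg j u) Bx) Px !brg adlin; alg_norm.
  by lcomb; ring.
pose brL x : {linear A -> A} :=
  HB.pack (br x) (GRing.isLinear.Build k A A *:%R (br x) (brr x)).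
have br0 x : br x 0 = 0 := linear0 (brL x).
have br_leib m n x y z : B m x -> B n y ->
    br x (y * z) = br x y * z + ksign (m * n) *: (y * br x z).
  move=> Bx By; move: m x Bx.
  apply: (fg_deg_ind fg) => [m|m a x x' Px Px'||m i v x Bx Px].
  - by rewrite !br0l mulr0 mul0r scaler0 addr0.
  - by rewrite !brl Px Px'; alg_norm; lcomb; ring.
  - by rewrite !br1l mulr0 mul0r scaler0 addr0.
  rewrite !(brMl _ _ _ _ _ (fg_deg fg i v) Bx) Px !brg (adM _ _ _ _ _ By).
  alg_norm; rewrite (comm (fg_deg fg i v) By) (comm Bx By); alg_norm.
  by lcomb; ksign_ring.
have br1 x : br x 1 = 0.
  move: x; apply: (fg_ind fg) => [|b x x' Px Px'||n j u x Bx Px] //.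
    by rewrite brl Px Px' scaler0 addr0.
  by rewrite (brMl _ _ _ _ _ (fg_deg fg j u) Bx) Px brg ad1 !mulr0 scaler0 addr0.
(* Antisymmetry holds on pairs of generators by [beta_anti]; it is extended to the second argument
   here, and to the first one at the end. *)
have br_antig i v n y : B n y ->
    br (gen i v) y = - ksign (deg i * n) *: br y (gen i v).
  move: n y; apply: (fg_deg_ind fg) => [n|n a x y Px Py||n j u x Bx Px].
  - by rewrite br0 br0l scaler0.
  - by rewrite brr brl Px Py; lcomb; ring.
  - by rewrite br1 br1l scaler0.
  rewrite (brMl _ _ _ _ _ (fg_deg fg j u) Bx).
  rewrite (br_leib _ _ _ _ _ (fg_deg fg i v) (fg_deg fg j u)) Px.
  have Bgg : B (deg i + deg j) (br (gen i v) (gen j u)).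
    by apply: br_deg; apply: (fg_deg fg).
  rewrite (comm Bgg Bx) !brg !adg [beta j u i v]beta_anti; alg_norm.
  by lcomb; ksign_ring.
exists br; last by move=> i v j w; rewrite brg adg.
split=> // m n x y Bx By; move: m x Bx.
apply: (fg_deg_ind fg) => [m|m a x x' Px Px'||m i v x Bx Px].
- by rewrite br0 br0l scaler0.
- by rewrite brr brl Px Px'; lcomb; ring.
- by rewrite br1 br1l scaler0.
rewrite (brMl _ _ _ _ _ (fg_deg fg i v) Bx).
rewrite (br_leib _ _ _ _ _ By (fg_deg fg i v)) Px (br_antig _ _ _ _ By).
have Byg : B (n + deg i) (br y (gen i v)) by apply: br_deg By (fg_deg fg i v).
by rewrite (comm Byg Bx); alg_norm; lcomb; ksign_ring.
Qed.

End Bracket.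

Section GradedLie.
Variable br : A -> A -> A.
Hypothesis bd : is_graded_biderivation B br.

Let brD x a y z : br x (a *: y + z) = a *: br x y + br x z :=
  bd_linear bd x a y z.
Let brDl x a y z : br (a *: y + z) x = a *: br y x + br z x :=
  bd_linearl bd x a y z.
Let brM := bd_leibniz bd.
Let anti := bd_anti bd.
Let brB := bd_deg bd.

Lemma bd0r x : br x 0 = 0.
Proof. by have := brD x (- 1) 0 0; rewrite scaler0 addr0 scaleN1r addNr. Qed.

Lemma bd0l x : br 0 x = 0.
Proof. by have := brDl x (- 1) 0 0; rewrite scaler0 addr0 scaleN1r addNr. Qed.

Lemma bdZr x a y : br x (a *: y) = a *: br x y.
Proof. by rewrite -[a *: y]addr0 brD bd0r addr0. Qed.

Lemma bdZl x a y : br (a *: y) x = a *: br y x.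
Proof. by rewrite -[a *: y]addr0 brDl bd0l addr0. Qed.

Lemma bdDr x y z : br x (y + z) = br x y + br x z.
Proof. by rewrite -[y]scale1r brD !scale1r. Qed.

Lemma bd1r x : br x 1 = 0.
Proof.
move: x; apply: homog_ind => [|a x y Px Py|n x Bx]; first exact: bd0l.
  by rewrite brDl Px Py scaler0 addr0.
have := brM 1 Bx (graded1 gA); rewrite !mulr1 mulr0 /ksign expr0 scale1r mul1r.
by move/eqP; rewrite -subr_eq subrr => /eqP.
Qed.

Definition jacobi m n x y z : Prop :=
  br x (br y z) = br (br x y) z + ksign (m * n) *: br y (br x z).

(* The defect of the identity is a derivation in z and is invariant, up to    *)
(* sign, under permutations of x, y, z; so each of them can be reduced to     *)
(* generators in turn.                                                        *)
Lemma jacobi_from_gen m n x y : B m x -> B n y ->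
  (forall i v, jacobi m n x y (gen i v)) -> forall z, jacobi m n x y z.
Proof.
move=> Bx By jac z; move: z; rewrite /jacobi.
apply: (fg_ind fg) => [|a z z' Pz Pz'||p i v z Bz Pz].
- by rewrite !bd0r scaler0 addr0.
- by rewrite !brD Pz Pz'; lcomb; ring.
- by rewrite !bd1r !bd0r scaler0 addr0.
have Bg := fg_deg fg i v; have Bxy := brB Bx By.
have Bxg := brB Bx Bg; have Byg := brB By Bg.
rewrite (brM z By Bg) (brM z Bx Bg) (brM z Bxy Bg).
rewrite !bdDr !bdZr (brM _ Bx Byg) (brM _ Bx Bg) (brM _ By Bxg) (brM _ By Bg).
by rewrite jac Pz; alg_norm; lcomb; ksign_ring.
Qed.

Lemma jacobi_swap12 m n p x y z : B m x -> B n y -> B p z ->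
  jacobi m n x y z -> jacobi n m y x z.
Proof.
rewrite /jacobi => Bx By Bz ->; rewrite (anti By Bx) bdZl.
by lcomb; ksign_ring.
Qed.

Lemma jacobi_swap23 m n p x y z : B m x -> B n y -> B p z ->
  jacobi m n x y z -> jacobi m p x z y.
Proof.
rewrite /jacobi => Bx By Bz jac.
rewrite (anti Bz By) bdZr jac (anti (brB Bx Bz) By) (anti Bz (brB Bx By)).
by lcomb; ksign_ring.
Qed.

Lemma graded_lie_from_gen :
  (forall i v j w l u, jacobi (deg i) (deg j) (gen i v) (gen j w) (gen l u)) ->
  is_graded_lie B br.
Proof.
move=> jac; split=> //.
move=> m n x y z Bx By; rewrite -/(jacobi m n x y z).
have Bg := fg_deg fg.
have jac1 i v j w := jacobi_from_gen (Bg i v) (Bg j w) (jac i v j w).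
have jac2 i v q t : B q t -> forall z, jacobi (deg i) q (gen i v) t z.
  move=> Bt; apply: jacobi_from_gen => // l u.
  by apply: (jacobi_swap23 (Bg i v) (Bg l u) Bt); apply: jac1.
apply: jacobi_from_gen => // l u.
apply: (jacobi_swap23 Bx (Bg l u) By); apply: (jacobi_swap12 (Bg l u) Bx By).
exact: jac2.
Qed.

Variable d : A -> A.
Hypothesis d_lin : linear d.
Hypothesis d_deg : forall n x, B n x -> B (n + 1) (d x).
Hypothesis dM : forall n x y, B n x ->
  d (x * y) = d x * y + ksign n *: (x * d y).
Hypothesis d1 : d 1 = 0.

Let dL : {linear A -> A} := HB.pack d (GRing.isLinear.Build k A A *:%R d d_lin).
Let d0 : d 0 = 0 := linear0 dL.
Let dD x y : d (x + y) = d x + d y := raddfD dL x y.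
Let dZ a x : d (a *: x) = a *: d x.
Proof. by rewrite -[a *: x]addr0 d_lin d0 addr0. Qed.

(** The square of an odd derivation is a derivation, since the two cross terms [d x * d y] have
    opposite signs. *)
Lemma differential_from_gen : (forall i v, d (d (gen i v)) = 0) ->
  is_differential B d.
Proof.
move=> dd; split=> //; apply: (fg_ind fg) => [|a x y Px Py||n i v x Bx Px].
- by rewrite !d0.
- by rewrite !d_lin Px Py scaler0 addr0.
- by rewrite d1 d0.
have Bg := fg_deg fg i v.
rewrite (dM _ Bg) dD dZ (dM _ (d_deg Bg)) (dM _ Bg) dd Px.
by rewrite mul0r mulr0; lcomb; ksign_ring.
Qed.

Definition compat m x y : Prop :=
  d (br x y) = br (d x) y + ksign m *: br x (d y).

(** For fixed [x] the defect of compatibility is a graded derivation in [y]; [compat_swap] later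
    lets [x] be treated in the same way. *)
Lemma compat_from_gen m x : B m x -> (forall i v, compat m x (gen i v)) ->
  forall y, compat m x y.
Proof.
move=> Bx comp y; move: y; rewrite /compat.
apply: (fg_ind fg) => [|a y y' Py Py'||p i v y By Py].
- by rewrite d0 !bd0r d0 scaler0 addr0.
- by rewrite brD !d_lin Py Py' !brD; lcomb; ring.
- by rewrite d1 !bd1r bd0r d0 scaler0 addr0.
have Bg := fg_deg fg i v; have Bdx := d_deg Bx; have Bdg := d_deg Bg.
have Bxg := brB Bx Bg.
rewrite (brM _ Bx Bg) (brM _ Bdx Bg) dD dZ (dM _ Bxg) !(dM _ Bg) comp Py.
rewrite bdDr bdZr (brM _ Bx Bdg) (brM _ Bx Bg).
by alg_norm; lcomb; ksign_ring.
Qed.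

Lemma compat_swap m n x y : B m x -> B n y -> compat m x y -> compat n y x.
Proof.
rewrite /compat => Bx By comp.
rewrite (anti By Bx) dZ comp (anti (d_deg By) Bx) (anti By (d_deg Bx)).
by lcomb; ksign_ring.
Qed.

Lemma differential_poisson_from_gen :
  (forall i v, d (d (gen i v)) = 0) ->
  (forall i v j w l u, jacobi (deg i) (deg j) (gen i v) (gen j w) (gen l u)) ->
  (forall i v j w, compat (deg i) (gen i v) (gen j w)) ->
  is_differential_poisson B d br.
Proof.
move=> dd jac comp; split=> //.
- exact: differential_from_gen.
- exact: graded_lie_from_gen.
move=> m x y Bx; apply: compat_from_gen => // j w.
apply: (compat_swap (fg_deg fg j w) Bx).
exact: (compat_from_gen (fg_deg fg j w)).
Qed.

End GradedLie.

End FreeGComm.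

(** * The Chevalley-Eilenberg algebra of tA[t] *)

Section EndCoordinates.
Variables (k : fieldType) (W : vectType k).

Local Notation E := 'End(W).
Local Notation Ed := 'Hom(E, k^o).
Local Notation w := (vbasis {:W}).
Local Notation n := (\dim {:W}).
Local Notation x_ := (@x_ k W).

Lemma linfunE (aT rT : vectType k) (f : aT -> rT) : linear f -> linfun f =1 f.
Proof.
move=> f_lin u.
pose F : {linear aT -> rT} :=
  HB.pack f (GRing.isLinear.Build k aT rT *:%R f f_lin).
exact: (lfunE F).
Qed.

Lemma x_E i j f : x_ i j f = coord w i (f w`_j).
Proof. by rewrite linfunE // => a g h; rewrite add_lfunE scale_lfunE linearP. Qed.

Lemma end_ext f g : (forall i j, x_ i j f = x_ i j g) -> f = g.
Proof.
move=> fg; apply/lfunP => u; rewrite (coord_vbasis (memvf u)) !linear_sum.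
apply: eq_bigr => j _; rewrite !linearZ /=; congr (_ *: _).
rewrite (coord_vbasis (memvf (f w`_j))) (coord_vbasis (memvf (g w`_j))).
by apply: eq_bigr => i _; rewrite -!x_E fg.
Qed.

Lemma x_comp i j (f g : E) :
  x_ i j (f \o g)%VF = \sum_l x_ i l f * x_ l j g.
Proof.
rewrite x_E comp_lfunE (coord_vbasis (memvf (g w`_j))) !linear_sum.
by apply: eq_bigr => l _; rewrite !linearZ /= !x_E mulrC.
Qed.

Definition elem (i j : 'I_n) : E := linfun (fun u => coord w j u *: w`_i).

Lemma elemE i j u : elem i j u = coord w j u *: w`_i.
Proof. by rewrite linfunE // => a v v'; rewrite linearP scalerDl scalerA. Qed.

Lemma x_elem i j l m : x_ i j (elem l m) = (i == l)%:R * (j == m)%:R.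
Proof.
rewrite x_E elemE linearZ /= !coord_free ?(basis_free (vbasisP _)) //.
by rewrite mulrC [l == i]eq_sym.
Qed.

Lemma end_expand f : f = \sum_i \sum_j x_ i j f *: elem i j.
Proof.
apply: end_ext => l m; rewrite linear_sum (bigD1 l) //= [X in _ + X]big1.
  rewrite addr0 linear_sum (bigD1 m) //= big1 => [|j jm].
    by rewrite linearZ /= x_elem !eqxx addr0 mulr1 [RHS]mulr1.
  by rewrite linearZ /= x_elem [m == j]eq_sym (negPf jm) mulr0 [LHS]mulr0.
move=> i il; rewrite linear_sum big1 // => j _.
by rewrite linearZ /= x_elem eq_sym (negPf il) mul0r [LHS]mulr0.
Qed.

Lemma dual_expand (xi : Ed) : xi = \sum_i \sum_j xi (elem i j) *: x_ i j.
Proof.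
apply/lfunP => f; rewrite {1}[f]end_expand linear_sum sum_lfunE.
apply: eq_bigr => i _; rewrite linear_sum sum_lfunE; apply: eq_bigr => j _.
by rewrite linearZ scale_lfunE; apply: mulrC.
Qed.

Lemma dual_ind (P : Ed -> Prop) : P 0 ->
  (forall a xi eta, P xi -> P eta -> P (a *: xi + eta)) ->
  (forall i j, P (x_ i j)) -> forall xi, P xi.
Proof.
move=> P0 PD Px xi; rewrite [xi]dual_expand; elim/big_rec: _ => // i y _ Py.
elim/big_rec: _ y Py => [|j z _ IH] y Py; first by rewrite add0r.
by rewrite -addrA; apply: PD => //; apply: IH.
Qed.

Lemma comp_linl (g : E) : linear (fun f : E => (f \o g)%VF : E).
Proof. by move=> a f f'; rewrite comp_lfunDl comp_lfunZl. Qed.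

Lemma comp_linr (f : E) : linear (fun g : E => (f \o g)%VF : E).
Proof. by move=> a g g'; rewrite comp_lfunDr comp_lfunZr. Qed.

Lemma elem_comp i j l m : (elem i j \o elem l m)%VF = (j == l)%:R *: elem i m.
Proof.
apply/lfunP => u; rewrite comp_lfunE scale_lfunE !elemE linearZ /=.
rewrite coord_free ?(basis_free (vbasisP _)) // !scalerA mulrC.
by rewrite [l == j]eq_sym.
Qed.

Lemma tr_endE (f g : E) : tr_end (f \o g)%VF = \sum_i \sum_j x_ i j f * x_ j i g.
Proof. by apply: eq_bigr => i _; rewrite x_comp. Qed.

Lemma tr_formE (a b : E) : tr_form a b = tr_end (a \o b)%VF.
Proof.
rewrite linfunE // => c f g; rewrite !tr_endE scaler_sumr -big_split.
apply: eq_bigr => i _; rewrite scaler_sumr -big_split; apply: eq_bigr => j _ /=.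
by rewrite linearP mulrDr mulrCA.
Qed.

Lemma tr_form_linear : linear (@tr_form k W).
Proof.
move=> c f g; apply/lfunP => b; rewrite add_lfunE scale_lfunE !tr_formE !tr_endE.
rewrite scaler_sumr -big_split; apply: eq_bigr => i _.
rewrite scaler_sumr -big_split; apply: eq_bigr => j _ /=.
by rewrite linearP mulrDl -mulrA.
Qed.

Lemma tr_form_elem i j : tr_form (elem i j) = x_ j i.
Proof.
apply/lfunP => f; rewrite tr_formE tr_endE (bigD1 i) //= (bigD1 j) //=.
rewrite x_elem !eqxx !mul1r !big1 ?addr0 // => [l li|l lj].
  by rewrite big1 // => m _; rewrite x_elem (negPf li) !mul0r.
by rewrite x_elem (negPf lj) mulr0 mul0r.
Qed.

(** The inverse of [tr_form] ([untrK], [tr_formK]). The indices of [elem] are exchanged because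
    $\operatorname{tr}(e_{ij}f)=x_{ji}(f)$. *)
Definition untr (xi : Ed) : E := \sum_i \sum_j xi (elem i j) *: elem j i.

Lemma untr_linear : linear untr.
Proof.
move=> a xi eta; rewrite scaler_sumr -big_split; apply: eq_bigr => i _.
rewrite scaler_sumr -big_split; apply: eq_bigr => j _ /=.
by rewrite add_lfunE scale_lfunE scalerDl -scalerA.
Qed.

Lemma untrK xi : tr_form (untr xi) = xi.
Proof.
pose L : {linear E -> Ed} :=
  HB.pack (@tr_form k W) (GRing.isLinear.Build k E Ed *:%R _ tr_form_linear).
rewrite -[LHS]/(L _) [RHS]dual_expand linear_sum; apply: eq_bigr => i _.
rewrite linear_sum; apply: eq_bigr => j _; rewrite linearZ /=.
by rewrite tr_form_elem.
Qed.

Lemma tr_formK a : untr (tr_form a) = a.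
Proof.
rewrite [RHS]end_expand exchange_big; apply: eq_bigr => i _.
apply: eq_bigr => j _; congr (_ *: _).
rewrite tr_formE tr_endE (bigD1 j) //= (bigD1 i) //=.
rewrite x_elem !eqxx !mulr1 !big1 ?addr0 // => [p pj|q qi].
  by rewrite big1 // => q _; rewrite x_elem (negPf pj) !mulr0.
by rewrite x_elem (negPf qi) mul0r mulr0.
Qed.

(** The exponents $-r$ and $r+1$ add up to 1, so the form on $A((t^{-1}))$ reduces to the trace form
    for every [r]. *)
Lemma loop_dualE r (a : E) : loop_dual r a = tr_form a.
Proof.
rewrite /loop_dual /tr_form; congr linfun; apply/funext => b.
by rewrite /loop_form -addn1 PoszD addKr eqxx.
Qed.

Lemma loop_br_linl p q (b : E) : linear (fun a : E => loop_br p q a b).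
Proof.
move=> c f g; rewrite /loop_br comp_linl comp_linr.
by lcomb; ring.
Qed.

Lemma loop_br_linr p q (a : E) : linear (loop_br p q a).
Proof.
move=> c f g; rewrite /loop_br comp_linl comp_linr.
by lcomb; ring.
Qed.

Lemma loop_br_anti p q (a b : E) :
  loop_br p q a b = - ksign (p * q) *: loop_br q p b a.
Proof. by rewrite /loop_br; lcomb; ksign_ring. Qed.

Lemma comp_subZl c (f g h : E) :
  ((f - c *: g) \o h)%VF = (f \o h)%VF - c *: (g \o h)%VF.
Proof. by rewrite comp_lfunDl comp_lfunNl -comp_lfunZl. Qed.

Lemma comp_subZr c (f g h : E) :
  (f \o (g - c *: h))%VF = (f \o g)%VF - c *: (f \o h)%VF.
Proof. by rewrite comp_lfunDr comp_lfunNr -comp_lfunZr. Qed.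

Lemma end_compA (f g h : E) : (f \o (g \o h))%VF = ((f \o g) \o h)%VF.
Proof. exact: comp_lfunA. Qed.

Lemma loop_br_jacobi p q r (a b c : E) :
  loop_br p (q + r) a (loop_br q r b c) =
  loop_br (p + q) r (loop_br p q a b) c +
  ksign (p * q) *: loop_br q (p + r) b (loop_br p r a c).
Proof.
rewrite /loop_br !(comp_subZl, comp_subZr) !end_compA.
by lcomb; ksign_ring.
Qed.

End EndCoordinates.

(** * Sums over pairs with p + q + 1 = r *)

Section Convolution.
Variable M : zmodType.

(* The sum runs over the pairs (p, q) such that p + q + 1 = r.                *)
Definition conv (r : nat) (F : nat -> nat -> M) : M :=
  \sum_(p < r) F p (r.-1 - p)%N.

Lemma eq_conv r F G : (forall p q, (p + q).+1 = r -> F p q = G p q) ->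
  conv r F = conv r G.
Proof. by move=> FG; apply: eq_bigr => p _; apply: FG; case: p => p /=; lia. Qed.

Lemma conv_recl r F : conv r.+1 F = F 0%N r + conv r (fun p q => F p.+1 q).
Proof.
rewrite /conv big_ord_recl subn0; congr (_ + _); apply: eq_bigr => p _.
by congr F; rewrite /= /bump /=; lia.
Qed.

Lemma convD r F G : conv r (fun p q => F p q + G p q) = conv r F + conv r G.
Proof. exact: big_split. Qed.

Lemma convN r F : conv r (fun p q => - F p q) = - conv r F.
Proof. exact: sumrN. Qed.

Lemma conv_rev r F : conv r F = conv r (fun p q => F q p).
Proof.
rewrite /conv (reindex_inj rev_ord_inj); apply: eq_bigr => p _.
by case: p => p /= pr; congr F; lia.
Qed.

(** Both sides run over the triples with $a+b+c+2=r$. *)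
Lemma conv_assoc r (F : nat -> nat -> nat -> M) :
  conv r (fun p q => conv p (fun a b => F a b q)) =
  conv r (fun p q => conv q (fun b c => F p b c)).
Proof.
elim: r F => [|r IH] F; first by rewrite /conv !big_ord0.
rewrite !conv_recl [conv 0 _]big_ord0 add0r -IH -convD.
by apply: eq_conv => p q _; rewrite conv_recl.
Qed.

(** The range of the first index is cut at [r]. *)
Lemma conv_split r s F : conv (r + s) F =
  conv r (fun p q => F p (q + s)%N) + conv s (fun p q => F (r + p)%N q).
Proof.
elim: r F => [|r IH] F; first by rewrite [conv 0 _]big_ord0 add0r.
by rewrite addSn !conv_recl IH addrA.
Qed.

End Convolution.

(** * Bracket and differential on the generators *)

Section LoopCochains.
Variables (k : fieldType) (W : vectType k).

Local Notation E := 'End(W).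
Local Notation Ed := 'Hom(E, k^o).
Local Notation n := (\dim {:W}).
Local Notation x_ := (@x_ k W).

Variables (A : algType k) (B : int -> A -> Prop) (gen : nat -> Ed -> A).
Hypothesis fg : is_free_gcomm CE_gen_deg B gen.

Let gA := fg_graded fg.

Definition coord_gen (r : nat) (i j : 'I_n) : A := gen r (x_ i j).

Local Notation X := coord_gen.

(** The bracket of $A[[t^{-1}]]$, transported to linear forms by the trace form. *)
Definition loop_beta (r : nat) (xi : Ed) (s : nat) (eta : Ed) : A :=
  gen (r + s) (tr_form (loop_br (- r%:Z) (- s%:Z) (untr xi) (untr eta))).

(** The formula of [CE_d_gen], for generators in an abstract algebra. *)
Definition loop_delta (r : nat) (xi : Ed) : A :=
  let e := vbasis {:E} in
  let e_dual u : Ed := linfun (fun b : E => coord e u b : k^o) in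
  - (2%:R)^-1 *: \sum_(p < r) \sum_(q < r | (p.+1 + q.+1 == r.+1)%N)
      \sum_(u < \dim {:E}) \sum_(v < \dim {:E})
        (ksign (p.+1%:Z * (1 - q.+1%:Z))
           * xi (loop_br p.+1%:Z q.+1%:Z e`_u e`_v))
        *: (gen p (e_dual u) * gen q (e_dual v)).

Lemma gen_sum r (J : Type) (s : seq J) (c : J -> k) (F : J -> Ed) :
  gen r (\sum_(j <- s) c j *: F j) = \sum_(j <- s) c j *: gen r (F j).
Proof.
have lin := fg_lin fg r.
pose L : {linear Ed -> A} :=
  HB.pack (gen r) (GRing.isLinear.Build k Ed A *:%R _ lin).
by rewrite -[LHS]/(L _) linear_sum; apply: eq_bigr => j _; rewrite linearZ.
Qed.

Lemma genD r xi eta : gen r (xi + eta) = gen r xi + gen r eta.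
Proof. by rewrite -[xi]scale1r (fg_lin fg) !scale1r. Qed.

Lemma gen0 r : gen r 0 = 0.
Proof. by have := fg_lin fg r (-1) 0 0; rewrite scaler0 addr0 scaleN1r addNr. Qed.

Lemma genZ r a xi : gen r (a *: xi) = a *: gen r xi.
Proof. by rewrite -[_ *: xi]addr0 (fg_lin fg) gen0 addr0. Qed.

Lemma genN r xi : gen r (- xi) = - gen r xi.
Proof. by rewrite -scaleN1r genZ scaleN1r. Qed.

Lemma loop_beta_linr r xi s : linear (loop_beta r xi s).
Proof.
move=> a eta eta'; rewrite /loop_beta untr_linear loop_br_linr tr_form_linear.
exact: (fg_lin fg).
Qed.

Lemma loop_beta_linl r s eta : linear (fun xi => loop_beta r xi s eta).
Proof.
move=> a xi xi'; rewrite /loop_beta untr_linear loop_br_linl tr_form_linear.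
exact: (fg_lin fg).
Qed.

Lemma CE_gen_degD r s : CE_gen_deg (r + s) = CE_gen_deg r + CE_gen_deg s.
Proof. by rewrite /CE_gen_deg PoszD opprD. Qed.

Lemma loop_beta_deg r xi s eta :
  B (CE_gen_deg r + CE_gen_deg s) (loop_beta r xi s eta).
Proof. by rewrite -CE_gen_degD; apply: (fg_deg fg). Qed.

Lemma tr_formZ c (a : E) : tr_form (c *: a) = c *: tr_form a.
Proof.
have tr0 : tr_form (0 : E) = 0.
  by have := tr_form_linear (-1) (0 : E) 0; rewrite scaler0 addr0 scaleN1r addNr.
by rewrite -[c *: a]addr0 tr_form_linear tr0 addr0.
Qed.

Lemma tr_formB (a b : E) : tr_form (a - b) = tr_form a - tr_form b.
Proof. by rewrite addrC -scaleN1r tr_form_linear scaleN1r addrC. Qed.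

Lemma loop_beta_anti r xi s eta : loop_beta r xi s eta =
  - ksign (CE_gen_deg r * CE_gen_deg s) *: loop_beta s eta r xi.
Proof. by rewrite /loop_beta loop_br_anti tr_formZ genZ addnC. Qed.

Lemma loop_beta_X r s i j l m : loop_beta r (x_ i j) s (x_ l m) =
  (i == m)%:R *: X (r + s) l j -
  (ksign (r%:Z * s%:Z) * (j == l)%:R) *: X (r + s) i m.
Proof.
rewrite /loop_beta -!tr_form_elem !tr_formK /loop_br !elem_comp mulrNN.
rewrite tr_formB !tr_formZ genD genN !genZ !tr_form_elem scalerA.
by rewrite [l == j]eq_sym.
Qed.

Lemma loop_delta_deg r xi : B (CE_gen_deg r + 1) (loop_delta r xi).
Proof.
apply: (homogZ fg); apply: (big_ind (B _)) => [||p _]; first exact: (graded0 gA).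
  exact: (homogD fg).
apply: (big_ind (B _)) => [||q pq]; [exact: (graded0 gA)|exact: (homogD fg)|].
apply: (big_ind (B _)) => [||u _]; [exact: (graded0 gA)|exact: (homogD fg)|].
apply: (big_ind (B _)) => [||v _]; [exact: (graded0 gA)|exact: (homogD fg)|].
apply: (homogZ fg).
have -> : CE_gen_deg r + 1 = CE_gen_deg p + CE_gen_deg q.
  by rewrite /CE_gen_deg; move/eqP: pq; lia.
by apply: (gradedM gA); apply: (fg_deg fg).
Qed.

Lemma loop_delta_linear r : linear (loop_delta r).
Proof.
move=> a xi eta; rewrite /loop_delta scalerA mulrC -scalerA -scalerDr.
congr (_ *: _); do 4!(rewrite scaler_sumr -big_split; apply: eq_bigr => ? _ /=).
by rewrite add_lfunE scale_lfunE mulrDr scalerDl scalerA mulrCA.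
Qed.

Definition coord_gen2 p q i j : A := \sum_l X p i l * X q l j.

Local Notation XX := coord_gen2.

Lemma dual_basis_expand (xi : Ed) :
  xi = \sum_(u < \dim {:E}) xi (vbasis {:E})`_u *:
    (linfun (fun b : E => coord (vbasis {:E}) u b : k^o) : Ed).
Proof.
apply/lfunP => f; rewrite {1}(coord_vbasis (memvf f)) linear_sum sum_lfunE.
apply: eq_bigr => u _; rewrite linearZ scale_lfunE linfunE; first exact: mulrC.
by move=> a g h; rewrite linearP.
Qed.

Lemma comm_gen p xi q eta : gen p xi * gen q eta =
  ksign (p%:Z * q%:Z) *: (gen q eta * gen p xi).
Proof. by rewrite (fg_comm fg (fg_deg fg p xi) (fg_deg fg q eta)) mulrNN. Qed.

Hypothesis two_neq0 : 2%:R != 0 :> k.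

(* In terms of the matrices X_r = (x_ij t^-r), the differential reads         *)
(* d X_r = - \sum_(p + q + 1 = r) (-1)^((p + 1) q) X_p X_q.                   *)
Lemma loop_delta_X r i j : loop_delta r (x_ i j) =
  - conv r (fun p q => ksign (p.+1%:Z * q%:Z) *: XX p q i j).
Proof.
pose F p q := ksign (p.+1%:Z * q%:Z) *: XX p q i j.
(* The two halves of the commutator give $X_pX_q$ and, after reordering the factors, $X_qX_p$.
   Reversing the sum turns these into twice the same total, which absorbs the factor $1/2$. *)
suff sumE (p q : nat) : (\sum_(u < \dim {:E}) \sum_(v < \dim {:E})
        (ksign (p.+1%:Z * (1 - q.+1%:Z))
           * x_ i j (loop_br p.+1%:Z q.+1%:Z (vbasis {:E})`_u (vbasis {:E})`_v))
        *: (gen p (linfun (fun b : E => coord (vbasis {:E}) u b : k^o)) *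
            gen q (linfun (fun b : E => coord (vbasis {:E}) v b : k^o))))
    = F p q + F q p.
  rewrite -[RHS]/(- conv r F) /loop_delta; set S := \sum_(p < r) _.
  have -> : S = conv r (fun p q => F p q + F q p).
    apply: eq_bigr => p _; have pr : (r.-1 - p < r)%N by case: p => p /=; lia.
    rewrite (big_pred1 (Ordinal pr)) ?sumE // => q /=.
    by rewrite -val_eqE /=; case: p q pr => p /= ? [q /= ?] _; apply/eqP/eqP; lia.
  have -> : conv r (fun p q => F p q + F q p) = conv r F + conv r F.
    by rewrite convD; congr (_ + _); rewrite [RHS]conv_rev.
  by lcomb; rewrite -[1 + 1]/(2%:R) mulNr mulVf.
pose e := vbasis {:E}.
pose e_ (u : 'I_(\dim {:E})) : Ed := linfun (fun b : E => coord e u b : k^o).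
have genE r' (xi : Ed) :
    gen r' xi = \sum_(u < \dim {:E}) xi e`_u *: gen r' (e_ u).
  by rewrite {1}[xi]dual_basis_expand gen_sum.
have genM xi eta : gen p xi * gen q eta =
    \sum_(u < \dim {:E}) \sum_(v < \dim {:E})
      (xi e`_u * eta e`_v) *: (gen p (e_ u) * gen q (e_ v)).
  rewrite genE [gen q eta]genE mulr_suml; apply: eq_bigr => u _.
  rewrite mulr_sumr; apply: eq_bigr => v _.
  by rewrite alg_mulZl alg_mulZr scalerA.
have x_loop a b : x_ i j (loop_br p.+1%:Z q.+1%:Z a b) =
    \sum_l (x_ i l a * x_ l j b -
            ksign (p.+1%:Z * q.+1%:Z) * (x_ l j a * x_ i l b)).
  rewrite /loop_br linearB linearZ /= !x_comp sumrB; congr (_ - _).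
  rewrite -[_ *: _]/(_ * _) mulr_sumr; apply: eq_bigr => l _.
  by rewrite [X in _ * X]mulrC.
transitivity (\sum_l (ksign (p.+1%:Z * (1 - q.+1%:Z)) *: (X p i l * X q l j) -
    (ksign (p.+1%:Z * (1 - q.+1%:Z)) * ksign (p.+1%:Z * q.+1%:Z)) *:
      (X p l j * X q i l))).
  under [RHS]eq_bigr => l _.
    rewrite /coord_gen !genM !scaler_sumr -sumrB.
    under eq_bigr => u _ do rewrite !scaler_sumr -sumrB.
    over.
  rewrite [RHS]exchange_big; apply: eq_bigr => u _.
  rewrite [RHS]exchange_big; apply: eq_bigr => v _ /=.
  rewrite x_loop mulr_sumr scaler_suml; apply: eq_bigr => l _.
  by rewrite -/e -/(e_ u) -/(e_ v); lcomb; ring.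
rewrite /F /coord_gen2 !scaler_sumr -big_split; apply: eq_bigr => l _ /=.
rewrite /coord_gen [gen p (x_ l j) * _]comm_gen.
by lcomb; ksign_ring.
Qed.

End LoopCochains.

Section ConvolutionAlgebra.
Variables (k : fieldType) (A : algType k).

Lemma conv_sum (J : finType) r (F : J -> nat -> nat -> A) :
  \sum_l conv r (F l) = conv r (fun p q => \sum_l F l p q).
Proof. exact: exchange_big. Qed.

Lemma conv_mull r (F : nat -> nat -> A) y :
  y * conv r F = conv r (fun p q => y * F p q).
Proof. exact: mulr_sumr. Qed.

Lemma conv_mulr r (F : nat -> nat -> A) y :
  conv r F * y = conv r (fun p q => F p q * y).
Proof. exact: mulr_suml. Qed.

Lemma conv_scale r (F : nat -> nat -> A) c :
  c *: conv r F = conv r (fun p q => c *: F p q).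
Proof. exact: scaler_sumr. Qed.

Lemma linear_conv (f : A -> A) r (F : nat -> nat -> A) : linear f ->
  f (conv r F) = conv r (fun p q => f (F p q)).
Proof.
move=> f_lin.
pose f' : {linear A -> A} :=
  HB.pack f (GRing.isLinear.Build k A A *:%R f f_lin).
exact: (linear_sum f').
Qed.

Lemma linear_opp (f : A -> A) x : linear f -> f (- x) = - f x.
Proof.
move=> f_lin.
pose f' : {linear A -> A} :=
  HB.pack f (GRing.isLinear.Build k A A *:%R f f_lin).
exact: (linearN f').
Qed.

Lemma linear_scale (f : A -> A) a x : linear f -> f (a *: x) = a *: f x.
Proof.
move=> f_lin.
pose f' : {linear A -> A} :=
  HB.pack f (GRing.isLinear.Build k A A *:%R f f_lin).
exact: (linearZ_LR f').
Qed.

Lemma linear_bigsum (f : A -> A) (J : finType) (F : J -> A) : linear f ->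
  f (\sum_l F l) = \sum_l f (F l).
Proof.
move=> f_lin.
pose f' : {linear A -> A} :=
  HB.pack f (GRing.isLinear.Build k A A *:%R f f_lin).
exact: (linear_sum f').
Qed.

End ConvolutionAlgebra.

(** * The Poisson axioms on generators *)

Section LoopPoisson.
Variables (k : fieldType) (W : vectType k).

Local Notation E := 'End(W).
Local Notation Ed := 'Hom(E, k^o).
Local Notation n := (\dim {:W}).
Local Notation x_ := (@x_ k W).

Variables (A : algType k) (B : int -> A -> Prop) (gen : nat -> Ed -> A).
Hypothesis fg : is_free_gcomm CE_gen_deg B gen.

Local Notation X := (coord_gen gen).
Local Notation XX := (coord_gen2 gen).

Definition coord_gen3 a b c i j : A := \sum_l XX a b i l * X c l j.

Local Notation XXX := coord_gen3.

Lemma XXXE a b c i j : XXX a b c i j = \sum_l X a i l * XX b c l j.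
Proof.
rewrite /coord_gen3 /coord_gen2; under eq_bigr => l _ do rewrite mulr_suml.
rewrite exchange_big; apply: eq_bigr => m _ /=; rewrite mulr_sumr.
by apply: eq_bigr => l _; rewrite mulrA.
Qed.

Variable br : A -> A -> A.
Hypothesis bd : is_graded_biderivation B br.
Hypothesis brg : forall r xi s eta,
  br (gen r xi) (gen s eta) = loop_beta gen r xi s eta.

Lemma loop_jacobi r xi s eta t zeta : jacobi br (CE_gen_deg r) (CE_gen_deg s)
  (gen r xi) (gen s eta) (gen t zeta).
Proof.
rewrite /jacobi !brg /loop_beta !tr_formK.
rewrite !PoszD !opprD loop_br_jacobi addrC tr_form_linear (fg_lin fg) addrC.
by rewrite -(addnA r s t) (addnCA s r t).
Qed.

Hypothesis two_neq0 : 2%:R != 0 :> k.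
Variable d : A -> A.
Hypothesis d_lin : linear d.
Hypothesis d_deg : forall n x, B n x -> B (n + 1) (d x).
Hypothesis dM : forall n x y, B n x ->
  d (x * y) = d x * y + ksign n *: (x * d y).
Hypothesis dg : forall r xi, d (gen r xi) = loop_delta gen r xi.

Lemma X_deg r i j : B (CE_gen_deg r) (X r i j).
Proof. exact: (fg_deg fg). Qed.

Lemma X_comm p i j q l m :
  X p i j * X q l m = ksign (p%:Z * q%:Z) *: (X q l m * X p i j).
Proof. exact: (comm_gen fg). Qed.

Lemma dX r i j :
  d (X r i j) = - conv r (fun p q => ksign (p.+1%:Z * q%:Z) *: XX p q i j).
Proof. by rewrite dg (loop_delta_X fg two_neq0). Qed.

Lemma dXX p q i j : d (XX p q i j) =
  - conv p (fun a b => ksign (a.+1%:Z * b%:Z) *: XXX a b q i j)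
  - ksign p%:Z *: conv q (fun b c => ksign (b.+1%:Z * c%:Z) *: XXX p b c i j).
Proof.
rewrite /coord_gen2 linear_bigsum //.
under eq_bigr => l _ do rewrite (dM _ (X_deg p i l)) !dX mulNr mulrN.
rewrite big_split /= sumrN; congr (- _ + _).
  under eq_bigr => l _ do rewrite conv_mulr.
  rewrite conv_sum; apply: eq_conv => a b _; rewrite /coord_gen3 scaler_sumr.
  by apply: eq_bigr => l _; rewrite scalerAl.
under eq_bigr => l _ do rewrite conv_mull scalerN.
rewrite sumrN -scaler_sumr conv_sum; congr (- _).
rewrite /ksign abszN; congr (_ *: _); apply: eq_conv => a b _.
by rewrite XXXE scaler_sumr; apply: eq_bigr => l _; rewrite scalerAr.
Qed.

(** Applying $d$ to the left or to the right factor of $X_pX_q$ yields the two bracketings of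
    $X_aX_bX_c$, with opposite signs; [conv_assoc] matches the two sums. *)
Lemma loop_ddX r i j : d (d (X r i j)) = 0.
Proof.
rewrite dX linear_opp // linear_conv //; apply/eqP; rewrite oppr_eq0; apply/eqP.
pose F a b c := ksign ((a + b).+2%:Z * c%:Z) *:
  (ksign (a.+1%:Z * b%:Z) *: XXX a b c i j).
transitivity (conv r (fun p q => - conv p (fun a b => F a b q)) +
              conv r (fun p q => conv q (fun b c => F p b c))).
  rewrite -convD; apply: eq_conv => p q pq.
  rewrite linear_scale // dXX scalerDr scalerN conv_scale; congr (- _ + _).
    by apply: eq_conv => a b ab; rewrite /F -ab.
  rewrite scalerN scalerA conv_scale -convN; apply: eq_conv => b c bc.
  by rewrite /F -bc; lcomb; rewrite -?PoszD; ksign_ring.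
by rewrite convN conv_assoc addNr.
Qed.

Lemma loop_dd r xi : d (d (gen r xi)) = 0.
Proof.
move: xi; apply: dual_ind => [|a xi eta Pxi Peta|i j]; last exact: loop_ddX.
- rewrite (gen0 fg); have d0 : d 0 = 0.
    by have := linear_scale 0 0 d_lin; rewrite !scale0r.
  by rewrite !d0.
- by rewrite (fg_lin fg) !d_lin Pxi Peta scaler0 addr0.
Qed.

Lemma brXX r s i j l m : br (X r i j) (X s l m) =
  (i == m)%:R *: X (r + s) l j -
  (ksign (r%:Z * s%:Z) * (j == l)%:R) *: X (r + s) i m.
Proof. by rewrite brg (loop_beta_X fg). Qed.

Lemma sum_pick (F : 'I_n -> A) i : \sum_u (i == u)%:R *: F u = F i.
Proof.
rewrite (bigD1 i) //= eqxx scale1r big1 ?addr0 // => u ui.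
by rewrite eq_sym (negPf ui) scale0r.
Qed.

(** In the first and last terms the Kronecker delta is consumed by the sum over the inner index,
    leaving a product of two entries that is not an entry of a matrix product. *)
Lemma brX_XX r p q i j l m : br (X r i j) (XX p q l m) =
  X (r + p) l j * X q i m
  - (ksign (r%:Z * p%:Z) * (j == l)%:R) *: XX (r + p) q i m
  + (ksign (r%:Z * p%:Z) * (i == m)%:R) *: XX p (r + q) l j
  - ksign (r%:Z * (p%:Z + q%:Z)) *: (X p l j * X (r + q) i m).
Proof.
rewrite /coord_gen2 linear_bigsum; last exact: (bd_linear bd).
transitivity (\sum_u (
    (i == u)%:R *: (X (r + p) l j * X q u m) -
    (ksign (r%:Z * p%:Z) * (j == l)%:R) *: (X (r + p) i u * X q u m) +
    (ksign (r%:Z * p%:Z) * (i == m)%:R) *: (X p l u * X (r + q) u j) -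
    ksign (r%:Z * (p%:Z + q%:Z)) *: ((j == u)%:R *: (X p l u * X (r + q) i m)))).
  apply: eq_bigr => u _.
  rewrite (bd_leibniz bd _ (X_deg r i j) (X_deg p l u)) !brXX mulrNN; alg_norm.
  by lcomb; ksign_ring.
rewrite !(big_split, sumrN) /= -!scaler_sumr; congr (_ - _ + _ - _ *: _).
  exact: (sum_pick (fun u => X (r + p) l j * X q u m)).
exact: (sum_pick (fun u => X p l u * X (r + q) i m)).
Qed.

Lemma loop_compatX r s i j l m :
  compat br d (CE_gen_deg r) (X r i j) (X s l m).
Proof.
rewrite /compat.
have BdX : B (CE_gen_deg r + 1) (d (X r i j)) by apply/d_deg/X_deg.
(* Antisymmetry puts the generator in the first argument, where [brX_XX] applies. *)
rewrite (bd_anti bd BdX (X_deg s l m)) brXX !dX.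
rewrite !(linear_opp _ (bd_linear bd _)) !(linear_conv _ _ (bd_linear bd _)).
set c1 : k := (i == m)%:R; set c2 : k := (j == l)%:R.
have d_sub x y a b : d (a *: x - b *: y) = a *: d x - b *: d y.
  by rewrite d_lin (linear_opp _ d_lin) (linear_scale _ _ d_lin).
rewrite d_sub !dX.
pose sg a b : k := ksign (a.+1%:Z * b%:Z).
pose G1 a b := sg a b *: XX a b l j.
pose G2 a b := sg a b *: XX a b i m.
pose C a b := ksign (r%:Z + b%:Z + b%:Z * s%:Z) *: (X a l j * X b i m).
pose e1 : k := ksign ((CE_gen_deg r + 1) * CE_gen_deg s).
pose e2 : k := ksign (CE_gen_deg r).
pose b2 : k := ksign (r%:Z * s%:Z) * c2.
pose R1 p q := e1 *: br (X s l m) (sg p q *: XX p q i j).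
pose R2 p q := - (e2 *: br (X r i j) (sg p q *: XX p q l m)).
(* The products of entries of X_a and X_b do not cancel for each (p, q), but  *)
(* only after summation: C0 compares the two splittings, at a = r and at      *)
(* a = s, of the sum over a + b + 1 = r + s.                                  *)
have C0 : conv r (fun p q => C q (s + p)%N - C (s + q)%N p) +
          conv s (fun p q => C (r + p)%N q - C p (r + q)%N) = 0.
  rewrite !convD !convN addrACA -opprD; apply/eqP; rewrite subr_eq0; apply/eqP.
  transitivity (conv (r + s) C).
    rewrite conv_split; congr (_ + _); rewrite [RHS]conv_rev.
    by apply: eq_conv => p q _; rewrite addnC.
  rewrite addnC conv_split addrC; congr (_ + _); first by rewrite [LHS]conv_rev.
  by apply: eq_conv => p q _; rewrite addnC.
(* The sum over $p+q+1=r+s$ in $dX_{r+s}$ is cut at [s] for [G1] and at [r] for [G2]: these are the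
   pieces which the brackets with $dX_r$ and $dX_s$ produce. *)
transitivity (conv r (fun p q => b2 *: G2 p (s + q)%N - c1 *: G1 (s + p)%N q) +
              conv s (fun p q => b2 *: G2 (r + p)%N q - c1 *: G1 p (r + q)%N)).
  pose V1 := conv s (fun p q => G1 p (r + q)%N).
  pose V2 := conv r (fun p q => G1 (s + p)%N q).
  pose V3 := conv r (fun p q => G2 p (s + q)%N).
  pose V4 := conv s (fun p q => G2 (r + p)%N q).
  have V12 : conv (r + s) G1 = V1 + V2.
    rewrite addnC conv_split; congr (_ + _).
    by apply: eq_conv => p q _; rewrite addnC.
  have V34 : conv (r + s) G2 = V3 + V4.
    rewrite conv_split; congr (_ + _).
    by apply: eq_conv => p q _; rewrite addnC.
  have V32 : conv r (fun p q => b2 *: G2 p (s + q)%N - c1 *: G1 (s + p)%N q) =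
      b2 *: V3 - c1 *: V2 by rewrite convD convN -!conv_scale.
  have V41 : conv s (fun p q => b2 *: G2 (r + p)%N q - c1 *: G1 p (r + q)%N) =
      b2 *: V4 - c1 *: V1 by rewrite convD convN -!conv_scale.
  transitivity (c1 *: - conv (r + s) G1 - b2 *: - conv (r + s) G2); first by [].
  by rewrite V12 V34 V32 V41; lcomb; ring.
transitivity (conv r R1 + conv s R2); last first.
  pose V1 := conv r (fun p q => br (X s l m) (sg p q *: XX p q i j)).
  pose V2 := conv s (fun p q => br (X r i j) (sg p q *: XX p q l m)).
  transitivity (- e1 *: - V1 + e2 *: - V2); last by [].
  have -> : conv r R1 = e1 *: V1 by rewrite conv_scale.
  have -> : conv s R2 = - (e2 *: V2) by rewrite conv_scale -convN.
  by lcomb; ring.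
(* Once the vanishing sum [C0] is added, the two sides agree for each pair [p], [q]. *)
rewrite -[RHS]addr0 -C0 addrACA -!convD; congr (_ + _).
  apply: eq_conv => p q pq; rewrite /R1 /G1 /G2 /C (bdZr bd) brX_XX.
  rewrite [X (s + p) i m * _]X_comm [X p i m * _]X_comm.
  rewrite [m == i]eq_sym [l == j]eq_sym -/c1 -/c2 /b2 /e1 /sg /CE_gen_deg -pq.
  by move: (c1) (c2) => f1 f2; lcomb; ksign_ring.
apply: eq_conv => p q pq; rewrite /R2 /G1 /G2 /C (bdZr bd) brX_XX.
rewrite -/c1 -/c2 /b2 /e2 /sg /CE_gen_deg -pq.
by move: (c1) (c2) => f1 f2; lcomb; ksign_ring.
Qed.

Lemma loop_compat r xi s eta :
  compat br d (CE_gen_deg r) (gen r xi) (gen s eta).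
Proof.
have d0 : d 0 = 0.
  by have := linear_scale 0 0 d_lin; rewrite !scale0r.
move: xi; apply: dual_ind => [|a xi xi' Pxi Pxi'|i j].
- by rewrite /compat (gen0 fg) d0 !(bd0l bd) d0 scaler0 addr0.
- rewrite /compat (fg_lin fg) !(bd_linearl bd) !d_lin Pxi Pxi'.
  by rewrite !(bd_linearl bd); lcomb; ring.
move: eta; apply: dual_ind => [|a xi xi' Pxi Pxi'|l m]; last exact: loop_compatX.
- by rewrite /compat (gen0 fg) d0 !(bd0r bd) d0 scaler0 addr0.
rewrite /compat (fg_lin fg) !(bd_linear bd) !d_lin Pxi Pxi'.
by rewrite !(bd_linear bd); lcomb; ring.
Qed.

End LoopPoisson.

Lemma loop_poisson (k : fieldType) (W : vectType k) (A : algType k)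
    (B : int -> A -> Prop) (gen : nat -> 'Hom('End(W), k^o) -> A) :
  is_free_gcomm CE_gen_deg B gen -> 2%:R != 0 :> k ->
  exists d br, [/\ is_differential_poisson B d br,
    forall r xi, d (gen r xi) = loop_delta gen r xi &
    forall r xi s eta, br (gen r xi) (gen s eta) = loop_beta gen r xi s eta].
Proof.
move=> fg two_neq0.
have [d [d_lin dg d_deg d1 dM]] :=
  free_diff fg (loop_delta_linear (W := W) gen) (loop_delta_deg fg).
have [br bd brg] := free_bracket fg (loop_beta_linr fg) (loop_beta_linl fg)
  (loop_beta_deg fg) (loop_beta_anti fg).
exists d, br; split=> //.
apply: (differential_poisson_from_gen fg bd d_lin d_deg dM d1).
- exact: (loop_dd fg two_neq0 d_lin dM dg).
- exact: (loop_jacobi fg brg).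
- exact: (loop_compat fg bd brg two_neq0 d_lin d_deg dg).
Qed.

Theorem CE_poisson (k : fieldType) (W : vectType k) : 2%:R != 0 :> k ->
  exists P : diff_poisson (@CE_deg k W), is_CE_poisson P.
Proof.
move=> two_neq0.
have fg : is_free_gcomm CE_gen_deg (@CE_deg k W) (@CE_gen k W) := gsym_free _ _.
have [d [br [dp dg brg]]] := loop_poisson fg two_neq0.
exists (DiffPoisson dp); split=> [r xi|r s a b]; first exact: dg.
rewrite !loop_dualE; apply: etrans (brg _ _ _ _) _.
by rewrite /loop_beta !tr_formK.
Qed.

(** * Cohomology in degree 0 *)

Section ZeroCommutes.
Variables (k : fieldType) (R : algType k).

Lemma zero_comml c (y : R) : 0 * y = c *: (y * 0).
Proof. by rewrite mul0r mulr0 scaler0. Qed.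

Lemma zero_commr c (y : R) : y * 0 = c *: (0 * y).
Proof. by rewrite mul0r mulr0 scaler0. Qed.

End ZeroCommutes.

Section MorphismExtension.
Variables (k : fieldType) (T R : algType k) (g : {linear T -> R}).

Lemma morph_linl a x x' y : g (x * y) = g x * g y -> g (x' * y) = g x' * g y ->
  g ((a *: x + x') * y) = g (a *: x + x') * g y.
Proof.
move=> gx gx'; rewrite alg_mulDl alg_mulZl !linearP /= gx gx'.
by rewrite alg_mulDl alg_mulZl.
Qed.

Lemma morph_linr a x y y' : g (x * y) = g x * g y -> g (x * y') = g x * g y' ->
  g (x * (a *: y + y')) = g x * g (a *: y + y').
Proof.
move=> gy gy'; rewrite alg_mulDr alg_mulZr !linearP /= gy gy'.
by rewrite alg_mulDr alg_mulZr.
Qed.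

End MorphismExtension.

(** The product of the values of [phi] along a word is multilinear and graded symmetric, so
    [gsym_word_lift] applies; multiplicativity is then checked on words. *)
Lemma gsym_alg_lift (k : fieldType) (I : choiceType) (deg : I -> int)
    (V : lmodType k) (R : algType k) (phi : I -> V -> R) :
  (forall i, linear (phi i)) ->
  (forall i v j w,
    phi i v * phi j w = ksign (deg i * deg j) *: (phi j w * phi i v)) ->
  exists g : {linear gsym deg V -> R}, [/\ g 1 = 1,
    forall x y, g (x * y) = g x * g y & forall i v, g (gen deg i v) = phi i v].
Proof.
move=> phi_lin phi_comm.
pose f (s : seq (I * V)) : R := \prod_(l <- s) phi l.1 l.2.
have f_nil : f [::] = 1 by rewrite /f big_nil.
have f_cons i v s : f ((i, v) :: s) = phi i v * f s by rewrite /f big_cons.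
have [g gE] := gsym_word_lift (gw_lin f_nil f_cons phi_lin)
  (gw_swap f_nil f_cons phi_comm).
exists g; split.
- by rewrite -(gword_nil deg V) gE.
- move=> x y; move: x; apply: gsym_word_ind => [|a x x' Px Px'|s].
  + by rewrite mul0r linear0 mul0r.
  + exact: morph_linl Px Px'.
  move: y; apply: gsym_word_ind => [|a y y' Py Py'|t].
  + by rewrite mulr0 linear0 mulr0.
  + exact: morph_linr Py Py'.
  by rewrite -gword_cat !gE (gw_cat f_nil f_cons).
by move=> i v; rewrite -gword1 gE f_cons f_nil mulr1.
Qed.

(** * The degree 0 part, its coboundaries and its bracket *)

Section DegreeZeroPart.
Variables (k : fieldType) (W : vectType k).

Local Notation E := 'End(W).
Local Notation Ed := 'Hom(E, k^o).
Local Notation n := (\dim {:W}).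
Local Notation x_ := (@x_ k W).

Variables (S : algType k) (BS : int -> S -> Prop) (lin_ : unit -> Ed -> S).
Hypothesis fgS : is_free_gcomm (fun _ : unit => 0) BS lin_.

Local Notation lin := (lin_ tt).

Variables (A : algType k) (B : int -> A -> Prop) (gen : nat -> Ed -> A).
Hypothesis fg : is_free_gcomm CE_gen_deg B gen.

Local Notation X := (coord_gen gen).
Local Notation XX := (coord_gen2 gen).

Let gA := fg_graded fg.

Variable iota : {linear S -> A}.
Hypothesis iota1 : iota 1 = 1.
Hypothesis iotaM : forall x y, iota (x * y) = iota x * iota y.
Hypothesis iota_lin : forall xi, iota (lin xi) = gen 0 xi.

Variable rho : {linear A -> S}.
Hypothesis rho1 : rho 1 = 1.
Hypothesis rhoM : forall x y, rho (x * y) = rho x * rho y.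
Hypothesis rho_gen0 : forall xi, rho (gen 0 xi) = lin xi.
Hypothesis rho_genS : forall r xi, rho (gen r.+1 xi) = 0.

Lemma pol_ind (P : S -> Prop) :
  P 0 -> (forall a x y, P x -> P y -> P (a *: x + y)) -> P 1 ->
  (forall xi x, P x -> P (lin xi * x)) -> forall x, P x.
Proof.
by move=> P0 PD P1 Pl; apply: (fg_ind fgS) => // _ [] xi x _; apply: Pl.
Qed.

Lemma iotaK x : rho (iota x) = x.
Proof.
move: x; apply: pol_ind => [|a x y Px Py||xi x Px].
- by rewrite !linear0.
- by rewrite !linearP Px Py.
- by rewrite iota1 rho1.
by rewrite iotaM iota_lin rhoM rho_gen0 Px.
Qed.

Lemma iota_deg x : B 0 (iota x).
Proof.
move: x; apply: pol_ind => [|a x y Px Py||xi x Px].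
- by rewrite linear0; apply: (graded0 gA).
- by rewrite linearP; apply: (gradedP gA).
- by rewrite iota1; apply: (graded1 gA).
rewrite iotaM iota_lin -[0]addr0; apply: (gradedM gA) => //.
exact: (fg_deg fg 0 xi).
Qed.

(* The generators have degrees <= 0, and those of degree 0 are the gen 0 xi.  *)
Lemma homog_nonpos m x : B m x ->
  (m = 0 -> iota (rho x) = x) /\ (0 < m -> x = 0).
Proof.
move: m x; apply: (fg_deg_ind fg) =>
  [m|m a x y [Px Qx] [Py Qy]||m r xi x Bx [Px Qx]].
- by rewrite !linear0.
- split=> [m0|m0]; first by rewrite !linearP /= Px ?Py.
  by rewrite Qx ?Qy // scaler0 addr0.
- by rewrite rho1 iota1.
rewrite /CE_gen_deg; split=> [m0|m0]; last first.
  by rewrite Qx ?mulr0 //; move: m0; lia.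
case: r m0 => [|r] m0; last by rewrite Qx ?mulr0 ?linear0 //; move: m0; lia.
by rewrite rhoM rho_gen0 iotaM iota_lin Px //; move: m0; rewrite oppr0 add0r.
Qed.

Lemma rhoK x : B 0 x -> iota (rho x) = x.
Proof. by move=> /homog_nonpos[+ _]; apply. Qed.

Variable d : A -> A.
Hypothesis dD : is_differential B d.
Hypothesis dg : forall r xi, d (gen r xi) = loop_delta gen r xi.

Let d_lin := diff_linear dD.

(** The differential lands in degree 1, which is zero. *)
Lemma d_iota x : d (iota x) = 0.
Proof.
have /homog_nonpos[_] := diff_deg dD (iota_deg x).
by apply; rewrite add0r.
Qed.

Hypothesis two_neq0 : 2%:R != 0 :> k.

Definition square_eq (f : S) : Prop :=
  exists i j : 'I_n, f = \sum_l lin (x_ i l) * lin (x_ l j).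

Lemma square_exact f : square_eq f -> exists2 b, B (- 1) b & iota f = d b.
Proof.
(* In $dX_1$ only the pair $p=q=0$ occurs, with sign $+1$ inside the sum, so $dX_1=-X_0^2$. *)
case=> i [j ->]; exists (- X 1 i j).
  rewrite -scaleN1r; apply: (homogZ fg); exact: (fg_deg fg 1%N (x_ i j)).
rewrite (linear_opp _ d_lin) (dX fg two_neq0 dg) opprK.
rewrite /conv big_ord_recl big_ord0 addr0 /= mulr0 /ksign expr0 scale1r.
rewrite linear_sum; apply: eq_bigr => l _.
by rewrite iotaM !iota_lin.
Qed.

Lemma rho_XX p q i j : (0 < p + q)%N -> rho (XX p q i j) = 0.
Proof.
move=> pq; rewrite linear_sum big1 // => l _; rewrite rhoM.
case: p pq => [|p] pq; last by rewrite rho_genS mul0r.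
by case: q pq => // q _; rewrite [rho (X q.+1 _ _)]rho_genS mulr0.
Qed.

(** As [rho] is multiplicative, generators suffice. There $dX_0=0$, $dX_1$ maps to the entries of
    $-X_0^2$, and for $r\ge 2$ each product in $dX_r$ has a factor killed by [rho]. *)
Lemma rho_d x : ideal_gen square_eq (rho (d x)).
Proof.
have d0 : d 0 = 0 by have := linear_scale 0 0 d_lin; rewrite !scale0r.
have d1 : d 1 = 0.
  have := diffM dD 1 (graded1 gA); rewrite !mulr1 /ksign expr0 scale1r mul1r.
  by move/eqP; rewrite -subr_eq subrr eq_sym => /eqP.
have rho_dX r i j : ideal_gen square_eq (rho (d (X r i j))).
  rewrite (dX fg two_neq0 dg) linearN; apply: ideal_genN.
  case: r => [|[|r]].
  - by rewrite [conv 0 _]big_ord0 linear0; apply: ideal_gen0.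
  - rewrite /conv big_ord_recl big_ord0 addr0 /= linearZ; apply: ideal_genZ.
    apply: ideal_gen_sub; exists i, j; rewrite linear_sum.
    by apply: eq_bigr => l _; rewrite rhoM !rho_gen0.
  rewrite linear_sum big1 => [|p _]; first exact: ideal_gen0.
  by rewrite linearZ /= rho_XX ?scaler0 //; case: p => p /=; lia.
have rho_dg r xi : ideal_gen square_eq (rho (d (gen r xi))).
  move: xi; apply: dual_ind => [|a xi eta Pxi Peta|i j]; last exact: rho_dX.
    by rewrite (gen0 fg) d0 linear0; apply: ideal_gen0.
  rewrite (fg_lin fg) d_lin linearP; apply: ideal_genD => //.
  exact: ideal_genZ.
move: x; apply: (fg_ind fg) => [|a x y Px Py||m r xi x Bx Px].
- by rewrite d0 linear0; apply: ideal_gen0.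
- by rewrite d_lin linearP; apply: ideal_genD => //; apply: ideal_genZ.
- by rewrite d1 linear0; apply: ideal_gen0.
rewrite (diffM dD _ (fg_deg fg r xi)) linearD linearZ !rhoM.
apply: ideal_genD; first exact: ideal_genMr.
exact/ideal_genZ/ideal_genMl.
Qed.

Variable br : A -> A -> A.
Hypothesis brL : is_graded_lie B br.
Hypothesis br_leibniz : forall m n x y z, B m x -> B n y ->
  br x (y * z) = br x y * z + ksign (m * n) *: (y * br x z).

Lemma lie_is_biderivation : is_graded_biderivation B br.
Proof. by case: brL. Qed.

(** The bracket of two elements of degree 0 has degree 0, so [rho] loses nothing ([rhoK]), and all
    Koszul signs are trivial. *)
Lemma iota_br_poisson : is_poisson (fun x y => rho (br (iota x) (iota y))).
Proof.
have bd := lie_is_biderivation.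
have ibr x y : iota (rho (br (iota x) (iota y))) = br (iota x) (iota y).
  by apply: rhoK; rewrite -[0]addr0; apply: (lie_deg brL); apply: iota_deg.
split.
- by move=> x a y z; rewrite linearP (lie_linear brL) linearP.
- move=> x y; rewrite (lie_anti brL (iota_deg x) (iota_deg y)).
  by rewrite mulr0 /ksign expr0 scaleN1r linearN.
- move=> x y z; rewrite !ibr (lie_jacobi brL _ (iota_deg x) (iota_deg y)).
  by rewrite mulr0 /ksign expr0 scale1r linearD.
move=> x y z; rewrite iotaM (br_leibniz _ (iota_deg x) (iota_deg y)).
by rewrite mulr0 /ksign expr0 scale1r linearD !rhoM !iotaK.
Qed.

Variable brS : S -> S -> S.
Hypothesis brS_poisson : is_poisson brS.
Hypothesis brS_lin : forall xi eta,
  iota (brS (lin xi) (lin eta)) = br (gen 0 xi) (gen 0 eta).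

(** Both sides are biderivations along [iota]. Agreement on linear functions spreads to the second
    argument and then, by antisymmetry, to the first. *)
Lemma iota_br x y : iota (brS x y) = br (iota x) (iota y).
Proof.
have bd := lie_is_biderivation.
have from_lin x' :
    (forall xi, iota (brS x' (lin xi)) = br (iota x') (iota (lin xi))) ->
    forall y', iota (brS x' y') = br (iota x') (iota y').
  move=> x'_lin; have bl := poisson_linear brS_poisson x'.
  have brS0 : brS x' 0 = 0 by have := linear_scale 0 0 bl; rewrite !scale0r.
  have brS1 : brS x' 1 = 0.
    have := poisson_leibniz brS_poisson x' 1 1; rewrite !mulr1 mul1r.
    by move/eqP; rewrite -subr_eq subrr eq_sym => /eqP.
  apply: pol_ind => [|a y' z Py Pz||xi y' Py].
  - by rewrite brS0 linear0 (bd0r bd).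
  - by rewrite bl !linearP Py Pz (lie_linear brL).
  - by rewrite brS1 iota1 linear0 (bd1r fg bd).
  rewrite (poisson_leibniz brS_poisson) linearD !iotaM Py x'_lin.
  rewrite (br_leibniz _ (iota_deg x') (iota_deg (lin xi))).
  by rewrite mulr0 /ksign expr0 scale1r.
have swap x' y' : iota (brS x' y') = br (iota x') (iota y') ->
    iota (brS y' x') = br (iota y') (iota x').
  rewrite (poisson_anti brS_poisson) linearN => xy.
  rewrite (lie_anti brL (iota_deg y') (iota_deg x')) -xy.
  by rewrite mulr0 /ksign expr0 scaleN1r opprK.
apply: (from_lin) => xi; apply: swap; apply: from_lin => eta.
by rewrite brS_lin !iota_lin.
Qed.

End DegreeZeroPart.

(** * The inclusion of the polynomials in X_0 and its retraction *)

Section KirillovKostant.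
Variables (k : fieldType) (W : vectType k).
Hypothesis two_neq0 : 2%:R != 0 :> k.

Local Notation Ed := 'Hom('End(W), k^o).
Local Notation S := (S_End_dual W).
Local Notation C := (CE W).

Lemma CE_free : is_free_gcomm CE_gen_deg (@CE_deg k W) (@CE_gen k W).
Proof. exact: gsym_free. Qed.

Lemma S_End_free :
  is_free_gcomm (fun _ : unit => 0) (@gsym_deg k unit (fun=> 0) Ed)
    (fun i : unit => gen (fun=> 0) i : Ed -> S).
Proof. exact: gsym_free. Qed.

Lemma ex_iota : exists iota : {linear S -> C}, [/\ iota 1 = 1,
  forall x y, iota (x * y) = iota x * iota y
& forall xi, iota (lin_fun xi) = CE_gen 0 xi].
Proof.
have phi_comm (i : unit) v (j : unit) w : CE_gen 0 v * CE_gen 0 w =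
    ksign ((fun=> 0) i * (fun=> 0) j) *: (CE_gen 0 w * CE_gen 0 v) :> C.
  exact: gen_comm.
have [g [g1 gM gE]] := gsym_alg_lift (fun _ => fg_lin CE_free 0) phi_comm.
by exists g; split; [exact: g1 | exact: gM | move=> xi; exact: (gE tt xi)].
Qed.

Lemma ex_rho : exists rho : {linear C -> S}, [/\ rho 1 = 1,
  forall x y, rho (x * y) = rho x * rho y,
  forall xi, rho (CE_gen 0 xi) = lin_fun xi
& forall r xi, rho (CE_gen r.+1 xi) = 0].
Proof.
pose phi r (v : Ed) : S := if r is 0%N then lin_fun v else 0.
have phi_lin r : linear (phi r).
  case: r => [|r] a v w /=; first exact: (fg_lin S_End_free tt).
  by rewrite scaler0 addr0.
have phi_comm r v s w :
    phi r v * phi s w =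
    ksign (CE_gen_deg r * CE_gen_deg s) *: (phi s w * phi r v).
  case: r => [|r]; last exact: zero_comml.
  case: s => [|s]; last exact: zero_commr.
  exact: (gen_comm (fun _ : unit => 0) tt v tt w).
have [g [g1 gM gE]] := gsym_alg_lift phi_lin phi_comm.
exists g; split; [exact: g1 | exact: gM | move=> xi; exact: (gE 0%N xi) |].
by move=> r xi; exact: (gE r.+1 xi).
Qed.

End KirillovKostant.

(** * The Poisson isomorphism between functions on PCom(W) and H^0 *)

Section H0Iso.
Variables (k : fieldType) (W : vectType k).
Hypothesis two_neq0 : 2%:R != 0 :> k.

Local Notation Ed := 'Hom('End(W), k^o).
Local Notation S := (S_End_dual W).
Local Notation C := (CE W).

Variable iota : {linear S -> C}.
Hypothesis iota1 : iota 1 = 1.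
Hypothesis iotaM : forall x y, iota (x * y) = iota x * iota y.
Hypothesis iota_lin : forall xi, iota (lin_fun xi) = CE_gen 0 xi.
Variable rho : {linear C -> S}.
Hypothesis rho1 : rho 1 = 1.
Hypothesis rhoM : forall x y, rho (x * y) = rho x * rho y.
Hypothesis rho_gen0 : forall xi, rho (CE_gen 0 xi) = lin_fun xi.
Hypothesis rho_genS : forall r xi, rho (CE_gen r.+1 xi) = 0.

Variable P : diff_poisson (@CE_deg k W).
Hypothesis hP : is_CE_poisson P.

Let fgS := S_End_free W.
Let fgC := CE_free W.

Lemma CE_diffE r xi : dp_d P (CE_gen r xi) = loop_delta (@CE_gen k W) r xi.
Proof. exact: (proj1 hP). Qed.

Lemma iota_CE_deg x : CE_deg 0 (iota x).
Proof. exact: (iota_deg fgS fgC iota1 iotaM iota_lin). Qed.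

Lemma iota_cocycle x : iota x \in Z0_pred P.
Proof.
apply/Z0_predP; split; first exact: iota_CE_deg.
exact: (d_iota fgS fgC iota1 iotaM iota_lin rho1 rhoM rho_gen0
  (dp_diff (dp_axioms P))).
Qed.

Definition iotaZ x : Z0 P := CocycleZ0 (iota_cocycle x).

Lemma iotaZ_linear : linear iotaZ.
Proof.
move=> a x y; apply: val_inj; apply: etrans (linearP iota a x y) _.
exact: (esym (linearP val a (iotaZ x) (iotaZ y))).
Qed.

Lemma iotaZ1 : iotaZ 1 = 1.
Proof. exact: val_inj. Qed.

Lemma iotaZM x y : iotaZ (x * y) = iotaZ x * iotaZ y.
Proof.
apply: val_inj; apply: etrans (iotaM x y) _.
exact: (esym (rmorphM val (iotaZ x) (iotaZ y))).
Qed.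

(** Coboundaries form an ideal among the cocycles ([ideal_gen_B0]), so [square_exact] on the
    defining equations is enough. *)
Lemma iotaZ_exact t : ideal_gen (@PCom_eq k W) t -> B0 (iotaZ t).
Proof.
move=> Jt; apply: ideal_gen_B0; elim: Jt => [|a s b x Ss _ IH].
  have -> : iotaZ 0 = 0 by apply: val_inj; apply: etrans (linear0 iota) _.
  exact: ideal_gen0.
have -> : iotaZ (a * s * b + x) = iotaZ a * iotaZ s * iotaZ b + iotaZ x.
  rewrite -!iotaZM -[in LHS](scale1r (a * s * b)) iotaZ_linear.
  by rewrite scale1r.
apply: ideal_genS IH.
exact: (square_exact fgC iotaM iota_lin (dp_diff (dp_axioms P)) CE_diffE
  two_neq0 Ss).
Qed.

Lemma rho_exact b : ideal_gen (@PCom_eq k W) (rho (dp_d P b)).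
Proof.
exact: (rho_d fgC rhoM rho_gen0 rho_genS (dp_diff (dp_axioms P)) CE_diffE
  two_neq0 b).
Qed.

Lemma iotaKP x : rho (iota x) = x.
Proof. exact: (iotaK fgS iota1 iotaM iota_lin rho1 rhoM rho_gen0 x). Qed.

Lemma rhoKP (z : Z0 P) : iotaZ (rho (val z)) = z.
Proof.
apply: val_inj.
exact: (rhoK fgC iota1 iotaM iota_lin rho1 rhoM rho_gen0 (Z0_deg z)).
Qed.

Definition to_H0 (q : O_PCom W) : H0 P := H0_class (iotaZ (repr q)).

Definition of_H0 (c : H0 P) : O_PCom W := alg_pi (rho (val (repr c))).

(** Independence of the representative: two lifts differ by an element of the ideal, which becomes
    exact. *)
Lemma to_H0E x : to_H0 (alg_pi x) = H0_class (iotaZ x).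
Proof.
apply/H0_classP; have -> : iotaZ (repr (alg_pi x : O_PCom W)) - iotaZ x =
    iotaZ (repr (alg_pi x : O_PCom W) - x).
  rewrite [in RHS]addrC -(scaleN1r x) iotaZ_linear scaleN1r; exact: addrC.
exact/iotaZ_exact/alg_repr.
Qed.

(** Independence of the cocycle: two representatives differ by a coboundary, which [rho] sends into
    the ideal. *)
Lemma of_H0E z : of_H0 (H0_class z) = alg_pi (rho (val z)).
Proof.
set z' := repr (H0_class z).
have /H0_classP[b _ zE] : H0_class z' = H0_class z.
  by rewrite /H0_class /alg_pi reprK.
apply/alg_piP; have -> : rho (val z') - rho (val z) = rho (dp_d P b).
  rewrite -zE; apply: etrans (esym (linearB rho _ _)) _.
  by congr (rho _); apply: esym; apply: (rmorphB val).
exact: rho_exact.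
Qed.

Lemma to_H0K : cancel to_H0 of_H0.
Proof.
move=> q; have [x ->] := alg_pi_surj q; rewrite to_H0E of_H0E.
by rewrite -[val _]/(iota x) iotaKP.
Qed.

Lemma of_H0K : cancel of_H0 to_H0.
Proof.
move=> c; have [z ->] := alg_pi_surj c.
rewrite -[alg_pi z]/(H0_class z) of_H0E to_H0E.
by rewrite rhoKP.
Qed.

Lemma to_H0_linear : linear to_H0.
Proof.
move=> a p q; have [x ->] := alg_pi_surj p; have [y ->] := alg_pi_surj q.
rewrite -linearP !to_H0E iotaZ_linear; exact: linearP.
Qed.

Lemma to_H0_monoid_morphism : monoid_morphism to_H0.
Proof.
split=> [|p q]; first by rewrite -[1]/(alg_pi 1) to_H0E iotaZ1.
have [x ->] := alg_pi_surj p; have [y ->] := alg_pi_surj q.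
rewrite -rmorphM !to_H0E iotaZM; exact: rmorphM.
Qed.

Let brL := dp_lie (dp_axioms P).

Lemma CE_br_gen0 (a b : 'End(W)) :
  dp_br P (CE_gen 0 (tr_form a)) (CE_gen 0 (tr_form b)) =
  CE_gen 0 (tr_form ((a \o b)%VF - (b \o a)%VF)).
Proof.
have brE : loop_br (- 0%:Z) (- 0%:Z) a b = (a \o b)%VF - (b \o a)%VF.
  by rewrite /loop_br oppr0 mul0r /ksign expr0 scale1r.
rewrite -brE -!(loop_dualE 0); exact: (proj2 hP 0%N 0%N a b).
Qed.

Lemma KK_End_iota brS : is_KK_End brS -> forall x y,
  iota (brS x y) = dp_br P (iota x) (iota y).
Proof.
case=> brS_poisson brS_tr.
have brS_lin xi eta : iota (brS (lin_fun xi) (lin_fun eta)) =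
    dp_br P (CE_gen 0 xi) (CE_gen 0 eta).
  (* By non-degeneracy of the trace form, the values prescribed on the forms [tr_form a] cover all
     linear functions. *)
  have tr_surj (zeta : Ed) : exists a, zeta = tr_form a.
    by exists (untr zeta); rewrite untrK.
  have [a ->] := tr_surj xi; have [b ->] := tr_surj eta; rewrite brS_tr.
  exact: etrans (iota_lin _) (esym (CE_br_gen0 a b)).
exact: (iota_br fgS fgC iota1 iotaM iota_lin brL (dp_leibniz (dp_axioms P))
  brS_poisson brS_lin).
Qed.

Lemma to_H0_br brKK : is_KK_PCom brKK -> forall f g,
  to_H0 (brKK f g) = H0_br (to_H0 f) (to_H0 g).
Proof.
case=> brS KK brE f g.
have [x ->] := alg_pi_surj f; have [y ->] := alg_pi_surj g.
rewrite brE !to_H0E H0_brE; congr H0_class; apply: val_inj.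
exact: (KK_End_iota KK x y).
Qed.

Lemma KK_PCom_of_H0 :
  is_KK_PCom (fun f g => of_H0 (H0_br (to_H0 f) (to_H0 g))).
Proof.
exists (fun x y => rho (dp_br P (iota x) (iota y))).
  split=> [|a b].
    exact: (iota_br_poisson fgS fgC iota1 iotaM iota_lin rho1 rhoM rho_gen0 brL
      (dp_leibniz (dp_axioms P))).
  apply: etrans (congr1 rho _) (rho_gen0 _).
  apply: etrans (CE_br_gen0 a b).
  exact: (congr2 (dp_br P) (iota_lin _) (iota_lin _)).
by move=> f g; rewrite !to_H0E H0_brE of_H0E.
Qed.

Lemma H0_iso brKK : is_KK_PCom brKK ->
  exists Phi : {linear O_PCom W -> H0 P},
    [/\ monoid_morphism Phi,
        bijective Phi,
        forall xi : Ed,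
          exists2 z : Z0 P, Z0_val z = CE_gen 0 xi
                          & Phi (alg_pi (lin_fun xi)) = H0_class z
      & forall f g : O_PCom W, Phi (brKK f g) = H0_br (Phi f) (Phi g)].
Proof.
move=> KK.
pose Phi : {linear O_PCom W -> H0 P} := HB.pack to_H0
  (GRing.isLinear.Build k (O_PCom W) (H0 P) *:%R to_H0 to_H0_linear).
exists Phi; split.
- exact: to_H0_monoid_morphism.
- exact: Bijective to_H0K of_H0K.
- move=> xi; exists (iotaZ (lin_fun xi)); first exact: iota_lin.
  exact: to_H0E.
- exact: to_H0_br.
Qed.

End H0Iso.

Theorem theorem2p12 (k : fieldType) (char0 : [pchar k] =i pred0)
    (W : vectType k) :
  (exists P : diff_poisson (@CE_deg k W), is_CE_poisson P)
  /\ (exists brKK : O_PCom W -> O_PCom W -> O_PCom W, is_KK_PCom brKK)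
  /\ (forall (P : diff_poisson (@CE_deg k W))
             (brKK : O_PCom W -> O_PCom W -> O_PCom W),
        is_CE_poisson P -> is_KK_PCom brKK ->
        exists Phi : {linear O_PCom W -> H0 P},
          [/\ monoid_morphism Phi,
              bijective Phi,
              forall xi : 'Hom('End(W), k^o),
                exists2 z : Z0 P, Z0_val z = CE_gen 0 xi
                                & Phi (alg_pi (lin_fun xi)) = H0_class z
            & forall f g : O_PCom W,
                Phi (brKK f g) = H0_br (Phi f) (Phi g)]).
Proof.
have two_neq0 : 2%:R != 0 :> k by have /pcharf0P -> := char0.
have [P0 hP0] := CE_poisson W two_neq0.
have [iota [iota1 iotaM iota_lin]] := ex_iota W.
have [rho [rho1 rhoM rho_gen0 rho_genS]] := ex_rho W.
split; first by exists P0.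
split; first exact: (ex_intro _ _ (KK_PCom_of_H0 two_neq0 iota1 iotaM iota_lin
  rho1 rhoM rho_gen0 rho_genS hP0)).
move=> P brKK hP KK.
exact: (H0_iso two_neq0 iota1 iotaM iota_lin rho1 rhoM rho_gen0 rho_genS hP KK).
Qed.
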